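(* Let $(p:\mathcal G\to M,\omega)$ be a parabolic geometry of type $G/P$, and let $\sigma$ and $\hat\sigma$ be two Weyl-structures related by $$\hat\sigma(u)=\sigma(u)\exp(\Upsilon_1(u))\cdots\exp(\Upsilon_k(u)),$$ where $\Upsilon=(\Upsilon_1,\dots,\Upsilon_k)$ is a smooth section of $\mathcal A_1\oplus\dots\oplus\mathcal A_k$. Denote quantities corresponding to $\hat\sigma$ by hatted symbols and those corresponding to $\sigma$ by unhatted symbols. Then for every $\xi\in TM$: (1) for $i<0$, $$\hat\xi_i=\sum_{\|\underline j\|+\ell=i}\frac{(-1)^{\underline j}}{\underline j!}\,\mathrm{ad}(\Upsilon_k)^{j_k}\circ\dots\circ\mathrm{ad}(\Upsilon_1)^{j_1}(\xi_\ell);$$ (2) for $i>0$, $$\begin{aligned}\hat{\mathsf P}_i(\xi)=&\sum_{\|\underline j\|+\ell=i}\frac{(-1)^{\underline j}}{\underline j!}\,\mathrm{ad}(\Upsilon_k)^{j_k}\circ\dots\circ\mathrm{ad}(\Upsilon_1)^{j_1}(\xi_\ell)\\&+\sum_{\|\underline j\|+\ell=i}\frac{(-1)^{\underline j}}{\underline j!}\,\mathrm{ad}(\Upsilon_k)^{j_k}\circ\dots\circ\mathrm{ad}(\Upsilon_1)^{j_1}(\mathsf P_\ell(\xi))\\&+\sum_{m=1}^k\ \sum_{\substack{(\underline j)_{m-1}=0\\ m+\|\underline j\|=i}}\frac{(-1)^{\underline j}}{(j_m+1)\,\underline j!}\,\mathrm{ad}(\Upsilon_k)^{j_k}\circ\dots\circ\mathrm{ad}(\Upsilon_m)^{j_m}(\nabla_\xi\Upsilon_m),\end{aligned}$$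 where $\mathrm{ad}$ denotes the adjoint action with respect to the algebraic bracket $\{\ ,\ \}$; (3) if $E$ is a vector bundle associated to the principal bundle $\mathcal G_0$ and $s$ is a smooth section of $E$, then $$\hat\nabla_\xi s=\nabla_\xi s+\sum_{\|\underline j\|+\ell=0}\frac{(-1)^{\underline j}}{\underline j!}\bigl(\mathrm{ad}(\Upsilon_k)^{j_k}\circ\dots\circ\mathrm{ad}(\Upsilon_1)^{j_1}(\xi_\ell)\bigr)\bullet s,$$ where $\bullet$ denotes the map $\mathcal A_0\times E\to E$ induced by the action of $\mathfrak g_0$ on the standard fiber of $E$.
   Context: **Groups.** $G$ is a real or complex semisimple Lie group (complex groups being regarded as real Lie groups, since only smooth real geometries are considered) whose Lie algebra carries a $|k|$-grading $\mathfrak g=\mathfrak g_{-k}\oplus\dots\oplus\mathfrak g_k$, $[\mathfrak g_i,\mathfrak g_j]\subset\mathfrak g_{i+j}$, such that no simple ideal of $\mathfrak g$ is contained in $\mathfrak g_0$ and $\mathfrak g_-=\mathfrak g_{-k}\oplus\dots\oplus\mathfrak g_{-1}$ is generated by $\mathfrak g_{-1}$. Put $\mathfrak p_+=\mathfrak g_1\oplus\dots\oplus\mathfrak g_k$, $\mathfrak p=\mathfrak g_0\oplus\mathfrak p_+$, $\mathfrak g^j=\mathfrak g_j\oplus\dots\oplus\mathfrak g_k$. $P\subset G$ is the closed subgroup of all elements whose adjoint action preserves every $\mathfrak g^j$; $G_0\subset P$ is the subgroup of elements whose adjoint action preserves every $\mathfrak g_i$; $P_+=\exp(\mathfrak p_+)$,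 and $P/P_+=G_0$. **Parabolic geometry.** A parabolic geometry $(p:\mathcal G\to M,\omega)$ of type $G/P$ is a smooth principal $P$-bundle with a one-form $\omega\in\Omega^1(\mathcal G,\mathfrak g)$ such that $\omega(\zeta_Z)=Z$ for fundamental vector fields $\zeta_Z$, $Z\in\mathfrak p$; $(r^b)^*\omega=\mathrm{Ad}(b^{-1})\circ\omega$ for $b\in P$; and $\omega|_{T_u\mathcal G}$ is a linear isomorphism onto $\mathfrak g$ for each $u\in\mathcal G$. Its underlying principal $G_0$-bundle is $p_0:\mathcal G_0=\mathcal G/P_+\to M$, with projection $\pi:\mathcal G\to\mathcal G_0$. **Bundles.** $\mathcal A_i=\mathcal G_0\times_{G_0}\mathfrak g_i$ (adjoint action), with sections identified with smooth functions $f:\mathcal G_0\to\mathfrak g_i$ satisfying $f(u\cdot g)=\mathrm{Ad}(g^{-1})f(u)$, $g\in G_0$. The Lie bracket of $\mathfrak g$ induces the algebraic bracket $\{\ ,\ \}:\mathcal A_i\times\mathcal A_j\to\mathcal A_{i+j}$. **Weyl-structures.** A Weyl-structure is a global smooth $G_0$-equivariant section $\sigma:\mathcal G_0\to\mathcal G$ of $\pi$. Let $\sigma^*\omega_i$ be the $\mathfrak g_i$-component of $\sigma^*\omega$. For $i\ne0$ it is horizontal and $G_0$-equivariant, hence descends to an $\mathcal A_i$-valued one-form on $M$; $\sigma^*\omega_0$ is a principal connection on $\mathcal G_0$ (the Weyl connection). The forms $\sigma^*\omega_i$, $i<0$, give an isomorphism $TM\cong\mathcal A_{-k}\oplus\dots\oplus\mathcal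 A_{-1}$, written $\xi\mapsto(\xi_{-k},\dots,\xi_{-1})$. The Rho-tensor is $\mathsf P=(\mathsf P_1,\dots,\mathsf P_k)$, $\mathsf P_i=\sigma^*\omega_i\in\Omega^1(M;\mathcal A_i)$ for $i>0$. $\nabla$ denotes the linear connection induced by $\sigma^*\omega_0$ on any vector bundle associated to $\mathcal G_0$. **Index notation.** $\underline j=(j_1,\dots,j_k)$ runs over sequences of nonnegative integers; $\|\underline j\|=j_1+2j_2+\dots+kj_k$; $\underline j!=j_1!\cdots j_k!$; $(-1)^{\underline j}=(-1)^{j_1+\dots+j_k}$; $(\underline j)_m=(j_1,\dots,j_m)$; $0$ denotes a sequence of zeros of any length. In sums involving $\xi_\ell$, $\ell$ runs over $-k,\dots,-1$; in sums involving $\mathsf P_\ell$, $\ell$ runs over $1,\dots,k$. *)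

(* Defs.v *)
From HB Require Import structures.
From mathcomp Require Import all_boot all_order all_algebra.
From mathcomp Require Import all_classical all_reals all_analysis.

Set Implicit Arguments.
Unset Strict Implicit.
Unset Printing Implicit Defensive.

Import Order.TTheory GRing.Theory Num.Theory.
Import numFieldNormedType.Exports.

Local Open Scope classical_set_scope.
Local Open Scope ring_scope.

(* C^oo on the open set U, for finite-dimensional V: all iterated directional
   derivatives of f are (Frechet) differentiable on U. *)
Definition smooth_on (R : realType) (V W : normedModType R) (f : V -> W)
    (U : set V) : Prop :=
  forall (vs : seq V) (x : V), U x ->
    differentiable (foldr (fun v (h : V -> W) => 'D_v h) f vs) x.

(* A homeomorphism from the open set cdom onto the open set cmap @` cdom;
   the values of cmap and cinv elsewhere are irrelevant. *)
Record chart (R : realType) (E : normedModType R) (M : topologicalType) := Chart {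
  cdom : set M;
  cmap : M -> E;
  cinv : E -> M;
  cdom_open : open cdom;
  cimg_open : open (cmap @` cdom);
  cmap_continuous : forall x, cdom x -> {for x, continuous cmap};
  cinv_continuous : forall y, (cmap @` cdom) y -> {for y, continuous cinv};
  cmapK : forall x, cdom x -> cinv (cmap x) = x }.

(* The smooth structure is given by an atlas indexed by the points of M.  The
   tangent space of M at x is represented by the model space E, through the
   coordinates of the chart chart_at x. *)
HB.mixin Record hasCharts (R : realType) (E : normedModType R) M
    of Topological M := {
  chart_at : M -> chart E M;
  chart_at_dom : forall x, cdom (chart_at x) x;
  chart_compat : forall x y,
    smooth_on (cmap (chart_at y) \o cinv (chart_at x))
      (cmap (chart_at x) @` (cdom (chart_at x) `&` cdom (chart_at y))) }.

#[short(type="chartedType")]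
HB.structure Definition Charted (R : realType) (E : normedModType R) :=
  {M of Topological M & hasCharts R E M}.


Section IdChart.
Context (R : realType) (E : normedModType R).

Lemma id_open : open (@idfun E @` setT).
Proof. by rewrite image_id; exact: openT. Qed.

Definition id_chart : chart E E :=
  @Chart R E E setT idfun idfun openT id_open
    (fun x _ => @cvg_id _ (nbhs x)) (fun x _ => @cvg_id _ (nbhs x))
    (fun x _ => erefl).

Lemma iter_derive_id (vs : seq E) :
  foldr (fun v (h : E -> E) => 'D_v h) (idfun \o idfun) vs = idfun \/
  exists c, foldr (fun v (h : E -> E) => 'D_v h) (idfun \o idfun) vs = cst c.
Proof.
elim: vs => [|v vs [IH|[c IH]]] /=; first by left.
- right; exists v; rewrite IH; apply/funext => x /=.
  by rewrite derive_id.
- by right; exists 0; rewrite IH; apply/funext => x /=; rewrite derive_cst.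
Qed.

Lemma id_chart_compat (x y : E) :
  smooth_on (cmap id_chart \o cinv id_chart)
    (cmap id_chart @` (cdom id_chart `&` cdom id_chart)).
Proof.
move=> vs z _; have [->|[c ->]] := iter_derive_id vs; first exact: ex_diff.
exact: differentiable_cst.
Qed.

End IdChart.

HB.instance Definition _ (R : realType) (m n : nat) :=
  @hasCharts.Build R 'M[R]_(m, n) 'M[R]_(m, n) (fun _ => @id_chart R 'M[R]_(m, n))
    (fun _ => I) (@id_chart_compat R 'M[R]_(m, n)).

Lemma open_setX (M N : topologicalType) (A : set M) (B : set N) :
  open A -> open B -> open (A `*` B).
Proof.
move=> oA oB; have -> : A `*` B = fst @^-1` A `&` snd @^-1` B by [].
apply: openI; apply: open_comp => // x _; [exact: cvg_fst|exact: cvg_snd].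
Qed.

Lemma near_eq_differentiable (R : realType) (V W : normedModType R)
    (f g : V -> W) (x : V) :
  (\near x, f x = g x) -> differentiable f x -> differentiable g x.
Proof.
move=> fg df; have [cf ef] := (diff_locallyP _ _).1 df.
have eg : g \o shift x = cst (g x) + 'd f x +o_ 0 id.
  apply/eqaddoP => e e0; move/eqaddoP : ef => /(_ e e0).
  have fg0 : \forall y \near 0, f (y + x) = g (y + x).
    by move: fg; rewrite (near_shift 0)/= subr0; apply: filterS => y.
  move=> efe; near=> y.
  suff -> : (g \o shift x - (cst (g x) + 'd f x)) y =
            (f \o shift x - (cst (f x) + 'd f x)) y by near: y.
  rewrite /= !fctE /=; rewrite (nbhs_singleton fg); congr (_ - _).
  by apply/esym; near: y.
by apply/diff_locallyP; rewrite (diff_unique cf eg).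
Unshelve. all: by end_near. Qed.

Section ProdChart.
Context (R : realType) (E F : normedModType R).

Section One.
Context (M N : topologicalType) (c : chart E M) (d : chart F N).

Let pdom := cdom c `*` cdom d.
Let pmap (z : M * N) := (cmap c z.1, cmap d z.2).
Let pinv (z : E * F) := (cinv c z.1, cinv d z.2).

Let pimg : pmap @` pdom = (cmap c @` cdom c) `*` (cmap d @` cdom d).
Proof.
apply/seteqP; split => [[u v] [[x y] [/= xc yd] [<- <-]]|[u v] /= [[x xc <-] [y yd <-]]].
  by split; [exists x|exists y].
by exists (x, y).
Qed.

Let pdom_open : open pdom.
Proof. by apply: open_setX; exact: cdom_open. Qed.

Let pimg_open : open (pmap @` pdom).
Proof. by rewrite pimg; apply: open_setX; exact: cimg_open. Qed.

Let pmap_continuous z : pdom z -> {for z, continuous pmap}.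
Proof.
move=> [z1 z2]; apply: (@cvg_pair _ _ _ _ (nbhs (cmap c z.1)) (nbhs (cmap d z.2))).
- by apply: cvg_comp; [exact: cvg_fst|exact: cmap_continuous].
- by apply: cvg_comp; [exact: cvg_snd|exact: cmap_continuous].
Qed.

Let pinv_continuous z : (pmap @` pdom) z -> {for z, continuous pinv}.
Proof.
rewrite pimg => -[z1 z2].
apply: (@cvg_pair _ _ _ _ (nbhs (cinv c z.1)) (nbhs (cinv d z.2))).
- by apply: cvg_comp; [exact: cvg_fst|exact: cinv_continuous].
- by apply: cvg_comp; [exact: cvg_snd|exact: cinv_continuous].
Qed.

Let pmapK z : pdom z -> pinv (pmap z) = z.
Proof. by case: z => x y [/= xc yd]; rewrite /pinv /= !cmapK. Qed.

Definition prod_chart : chart (E * F)%type (M * N)%type :=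
  @Chart R (E * F)%type (M * N)%type pdom pmap pinv
    pdom_open pimg_open pmap_continuous pinv_continuous pmapK.

End One.

Lemma smooth_on_prod (E' F' : normedModType R) (f : E -> E') (g : F -> F')
    (A : set E) (B : set F) : open A -> open B ->
  smooth_on f A -> smooth_on g B ->
  smooth_on (fun z : E * F => (f z.1, g z.2)) (A `*` B).
Proof.
move=> oA oB fA gB vs.
pose D (V W : normedModType R) (h : V -> W) := foldr (fun v (h : V -> W) => 'D_v h) h.
have fst_diff (z : E * F) : differentiable fst z.
  by apply: linear_differentiable => w; exact: cvg_fst.
have snd_diff (z : E * F) : differentiable snd z.
  by apply: linear_differentiable => w; exact: cvg_snd.
have dfst (z : E * F) : A z.1 -> forall vs, differentiable (fun z : E * F => D _ _ f vs z.1) z.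
  by move=> Az ws; apply: (@differentiable_comp _ _ _ _ fst (D _ _ f ws)); [exact: fst_diff|exact: fA].
have dsnd (z : E * F) : B z.2 -> forall vs, differentiable (fun z : E * F => D _ _ g vs z.2) z.
  by move=> Bz ws; apply: (@differentiable_comp _ _ _ _ snd (D _ _ g ws)); [exact: snd_diff|exact: gB].
have nAB (z : E * F) : A z.1 -> B z.2 -> \forall w \near z, (A `*` B) w.
  by move=> Az Bz; apply: open_nbhs_nbhs; split => //; exact: open_setX.
have key z : (A `*` B) z -> D _ _ (fun z : E * F => (f z.1, g z.2)) vs z =
    (D _ _ f (map fst vs) z.1, D _ _ g (map snd vs) z.2).
  elim: vs z => [//|v vs IH] z [Az Bz] /=.
  rewrite -(@near_eq_derive _ _ _
    (fun z => (D _ _ f (map fst vs) z.1, D _ _ g (map snd vs) z.2))); last first.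
    by near=> w; rewrite -IH//; near: w; exact: nAB.
  rewrite deriveE; last by apply: differentiable_pair; [exact: dfst|exact: dsnd].
  rewrite diff_pair; [|exact: dfst|exact: dsnd].
  rewrite (@diff_comp _ _ _ _ fst (D _ _ f (map fst vs)))//; last exact: fA.
  rewrite (@diff_comp _ _ _ _ snd (D _ _ g (map snd vs)))//; last exact: gB.
  rewrite (_ : 'd fst z = fst :> (_ -> _)); last first.
    by apply: diff_lin => w; exact: cvg_fst.
  rewrite (_ : 'd snd z = snd :> (_ -> _)); last first.
    by apply: diff_lin => w; exact: cvg_snd.
  by rewrite /= -!deriveE //; [exact: gB|exact: fA].
move=> z [Az Bz].
apply: (@near_eq_differentiable _ _ _
  (fun z => (D _ _ f (map fst vs) z.1, D _ _ g (map snd vs) z.2))).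
  by near=> w; rewrite -key//; near: w; exact: nAB.
by apply: differentiable_pair; [exact: dfst|exact: dsnd].
Unshelve. all: by end_near. Qed.

End ProdChart.

Lemma chart_img_open (R : realType) (E : normedModType R) (M : topologicalType)
    (c : chart E M) (U : set M) : open U -> U `<=` cdom c -> open (cmap c @` U).
Proof.
move=> oU Uc; rewrite openE => _ [x Ux <-].
have cx : (cmap c @` cdom c) (cmap c x) by exists x => //; exact: Uc.
have h1 : \forall y \near cmap c x, (cmap c @` cdom c) y.
  by apply: open_nbhs_nbhs; split => //; exact: cimg_open.
have h2 : \forall y \near cmap c x, U (cinv c y).
  apply: (cinv_continuous cx); rewrite cmapK; last exact: Uc.
  exact: open_nbhs_nbhs.
apply: filterS2 h1 h2 => y [z cz <-]; rewrite cmapK//.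
Qed.

Section ProdCompat.
Context (R : realType) (E F : normedModType R).
Context (M : chartedType E) (N : chartedType F).

Let pchart (z : M * N) := prod_chart (chart_at z.1) (chart_at z.2).

Lemma prod_chart_dom (z : M * N) : cdom (pchart z) z.
Proof. by split; exact: chart_at_dom. Qed.

Lemma prod_chart_compat (z w : M * N) :
  smooth_on (cmap (pchart w) \o cinv (pchart z))
    (cmap (pchart z) @` (cdom (pchart z) `&` cdom (pchart w))).
Proof.
pose A := cmap (chart_at z.1) @` (cdom (chart_at z.1) `&` cdom (chart_at w.1)).
pose B := cmap (chart_at z.2) @` (cdom (chart_at z.2) `&` cdom (chart_at w.2)).
have oA : open A by apply: chart_img_open => //; apply: openI; exact: cdom_open.
have oB : open B by apply: chart_img_open => //; apply: openI; exact: cdom_open.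
have H := smooth_on_prod oA oB (@chart_compat _ _ _ z.1 w.1) (@chart_compat _ _ _ z.2 w.2).
by move=> vs v [u [[/= u1 u2] [/= u3 u4]] uv]; apply: H; rewrite -uv; split; [exists u.1|exists u.2].
Qed.

End ProdCompat.

HB.instance Definition _ (R : realType) (E F : normedModType R)
    (M : chartedType E) (N : chartedType F) :=
  @hasCharts.Build R (E * F)%type (M * N)%type
    (fun z => prod_chart (chart_at z.1) (chart_at z.2))
    (@prod_chart_dom R E F M N) (@prod_chart_compat R E F M N).

HB.mixin Record isManifold (R : realType) (E : normedModType R) M
    of Charted R E M := {
  manifold_hausdorff : hausdorff_space M;
  manifold_second_countable : @second_countable M }.

#[short(type="manifoldType")]
HB.structure Definition Manifold (R : realType) (E : normedModType R) :=
  {M of Charted R E M & isManifold R E M}.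

Section Smooth.
Context (R : realType) (E F : normedModType R).
Context (M : chartedType E) (N : chartedType F).

Definition chart_rep (f : M -> N) (x : M) : E -> F :=
  cmap (chart_at (f x)) \o f \o cinv (chart_at x).

(* smooth in a neighbourhood of x *)
Definition smooth_at (f : M -> N) (x : M) : Prop :=
  {for x, continuous f} /\
  exists2 U, open_nbhs (cmap (chart_at x) x) U & smooth_on (chart_rep f x) U.

Definition smooth (f : M -> N) : Prop := forall x, smooth_at f x.

(* A map defined on a subset is smooth if locally it is the restriction of a
   smooth map.  For a closed subgroup A of a Lie group (an embedded
   submanifold) this is smoothness for its structure of Lie subgroup. *)
Definition smooth_within (A : set M) (f : M -> N) : Prop :=
  forall x, A x -> exists2 g : M -> N,
    smooth_at g x & \forall y \near x, A y -> g y = f y.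

Definition tangent (f : M -> N) (x : M) : {linear E -> F} :=
  'd (chart_rep f x) (cmap (chart_at x) x).

Definition velocity (c : R -> M) (t : R) : E := derive1 (cmap (chart_at (c t)) \o c) t.

End Smooth.

(* A W-valued one-form is smooth if its contraction with every coordinate
   vector field is: 'd (...) y v below is the coordinate vector field v of the
   chart chart_at x, at the point cinv (chart_at x) y. *)
Definition smooth_form (R : realType) (E W : normedModType R) (M : chartedType E)
    (w : M -> {linear E -> W}) : Prop :=
  forall (x : M) (v : E), let c := chart_at x in
    exists2 U, open_nbhs (cmap c x) U &
    smooth_on (fun y => w (cinv c y)
      ('d (cmap (chart_at (cinv c y)) \o cinv c) y v)) U.

HB.mixin Record isLieGroup (R : realType) (E : normedModType R) G
    of Manifold R E G & Group G := {
  mulg_smooth : smooth (fun z : G * G => (z.1 * z.2)%g);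
  invg_smooth : smooth (fun x : G => x^-1%g) }.

#[short(type="lieGroupType")]
HB.structure Definition LieGroup (R : realType) (E : normedModType R) :=
  {G of Manifold R E G & Group G & isLieGroup R E G}.

(* The Lie algebra of G is the tangent space at 1, that is, the model space. *)
Section LieAlgebra.
Context (R : realType) (n : nat) (G : lieGroupType 'rV[R]_n).
Local Notation g := 'rV[R]_n.

Definition Ad (b : G) : {linear g -> g} := tangent (fun x : G => (b * x * b^-1)%g) 1%g.

(* ad is the derivative of Ad at the neutral element *)
Definition bracket (X Y : g) : g := tangent (fun b : G => Ad b Y) 1%g X.

(* t |-> exp (t X) is the one-parameter subgroup with initial velocity X; this
   determines exp, and its smoothness is a consequence. *)
Record is_exponential (exp : g -> G) : Prop := {
  exp_smooth : smooth exp;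
  exp_addM : forall (X : g) (s t : R),
    exp ((s + t) *: X) = (exp (s *: X) * exp (t *: X))%g;
  exp_velocity : forall X : g, velocity (fun t => exp (t *: X)) 0 = X }.

Definition is_ideal (I : {vspace g}) : Prop :=
  forall X Y, Y \in I -> bracket X Y \in I.

Definition derived (U : {vspace g}) : {vspace g} :=
  <<[seq bracket X Y | X <- vbasis U, Y <- vbasis U]>>%VS.

Definition semisimple : Prop :=
  forall I, is_ideal I -> (exists m, iter m derived I = 0%VS) -> I = 0%VS.

Definition simple_ideal (I : {vspace g}) : Prop :=
  [/\ is_ideal I, exists X Y, [/\ X \in I, Y \in I & bracket X Y != 0] &
    forall J : {vspace g}, (J <= I)%VS ->
      (forall X Y, X \in I -> Y \in J -> bracket X Y \in J) ->
      J = 0%VS \/ J = I].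

Section Grading.
Context (k : nat) (gr : int -> {vspace g}).

Definition degrees : seq int := [seq i%:Z - k%:Z | i <- iota 0 k.*2.+1].

Definition gr_comp (i : int) : 'End(g) :=
  daddv_pi (gr i) (\sum_(j <- degrees | j != i) gr j)%VS.

Definition gr_filt (j : int) : {vspace g} := (\sum_(i <- degrees | (j <= i)%R) gr i)%VS.

Definition gr_minus : {vspace g} := (\sum_(i <- degrees | (i < 0)%R) gr i)%VS.

Record is_grading : Prop := {
  gr_sum : (\sum_(i <- degrees) gr i)%VS = fullv;
  gr_direct : directv (\sum_(i <- degrees) gr i);
  gr_out : forall i, i \notin degrees -> gr i = 0%VS;
  gr_bracket : forall i j X Y, X \in gr i -> Y \in gr j -> bracket X Y \in gr (i + j);
  gr_simple : forall I, simple_ideal I -> ~~ (I <= gr 0)%VS;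
  gr_generated : forall U : {vspace g}, (gr (- 1) <= U)%VS ->
    (forall X Y, X \in U -> Y \in U -> bracket X Y \in U) -> (gr_minus <= U)%VS }.

Definition parabolic : set G :=
  [set b | forall j X, X \in gr_filt j -> Ad b X \in gr_filt j].

Definition levi : set G := [set b | forall i X, X \in gr i -> Ad b X \in gr i].

Definition P_plus (exp : g -> G) : set G :=
  [set exp Z | Z in [set Z | Z \in gr_filt 1]].

End Grading.
End LieAlgebra.

(* Smooth principal H-bundle p : B -> M, for a closed subgroup H of G acting
   by r from the right (r is only relevant for group elements in H).  Local
   triviality: s is a local section over U, and u |-> (p u, tau u) is inverse
   to (y, b) |-> r (s y) b. *)
Record principal_bundle (R : realType) (n d m : nat) (G : lieGroupType 'rV[R]_n)
    (H : set G) (B : manifoldType 'rV[R]_d) (M : manifoldType 'rV[R]_m)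
    (p : B -> M) (r : B -> G -> B) : Prop := {
  pb_proj_smooth : smooth p;
  pb_act1 : forall u, r u 1%g = u;
  pb_actM : forall u a b, H a -> H b -> r (r u a) b = r u (a * b)%g;
  pb_act_fiber : forall u b, H b -> p (r u b) = p u;
  pb_act_smooth : smooth_within [set z : B * G | H z.2] (fun z => r z.1 z.2);
  pb_trivial : forall x, exists (U : set M) (s : M -> B) (tau : B -> G),
    [/\ open_nbhs x U,
        smooth_within U s,
        smooth_within (p @^-1` U) tau,
        forall y, U y -> p (s y) = y /\ (forall b, H b -> tau (r (s y) b) = b) &
        forall u, U (p u) -> H (tau u) /\ r (s (p u)) (tau u) = u] }.

Section ParabolicGeometry.
Context (R : realType) (n d d0 m k : nat) (G : lieGroupType 'rV[R]_n).
Context (gr : int -> {vspace 'rV[R]_n}) (exp : 'rV[R]_n -> G).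
Context (B : manifoldType 'rV[R]_d) (B0 : manifoldType 'rV[R]_d0).
Context (M : manifoldType 'rV[R]_m).
Context (p : B -> M) (r : B -> G -> B) (omega : B -> {linear 'rV[R]_d -> 'rV[R]_n}).
Context (p0 : B0 -> M) (r0 : B0 -> G -> B0) (pi : B -> B0).

Local Notation g := 'rV[R]_n.
Local Notation P := (@parabolic R n G k gr).
Local Notation G0 := (@levi R n G gr).

Record parabolic_geometry : Prop := {
  pg_bundle : principal_bundle P p r;
  pg_smooth : smooth_form omega;
  pg_fundamental : forall u (Z : g), Z \in gr_filt k gr 0 ->
    omega u (velocity (fun t => r u (exp (t *: Z))) 0) = Z;
  pg_equivariant : forall u b (eta : 'rV[R]_d), P b ->
    omega (r u b) (tangent (fun v => r v b) u eta) = Ad b^-1%g (omega u eta);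
  pg_parallelism : forall u, bijective (omega u) }.

(* pi : B -> B0 is the quotient by P_+ (a surjective submersion whose fibres
   are the orbits of P_+), with the induced projection to M and action of
   G_0. *)
Record underlying_bundle : Prop := {
  ub_smooth : smooth pi;
  ub_surj : forall v, exists u, pi u = v;
  ub_submersion : forall u (eta : 'rV[R]_d0), exists zeta, tangent pi u zeta = eta;
  ub_fiber : forall u v, pi u = pi v <->
    exists2 b, P_plus k gr exp b & v = r u b;
  ub_proj : forall u, p0 (pi u) = p u;
  ub_act : forall u b, G0 b -> pi (r u b) = r0 (pi u) b;
  ub_bundle : principal_bundle G0 p0 r0 }.

Record weyl_structure (sigma : B0 -> B) : Prop := {
  weyl_smooth : smooth sigma;
  weyl_section : forall u, pi (sigma u) = u;
  weyl_equivariant : forall u b, G0 b -> sigma (r0 u b) = r (sigma u) b }.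

(* Representations of G_0 on R^q; sections of the associated bundle are
   identified with equivariant functions on B0, and the value of a section at
   x is represented by the value of that function at a point u over x. *)
Record representation (q : nat) (rho : G -> 'rV[R]_q -> 'rV[R]_q) : Prop := {
  rep_linear : forall b, G0 b -> linear (rho b);
  rep1 : forall v, rho 1%g v = v;
  repM : forall a b v, G0 a -> G0 b -> rho (a * b)%g v = rho a (rho b v);
  rep_smooth : smooth_within [set z : G * 'rV[R]_q | G0 z.1]
    (fun z => rho z.1 z.2) }.

Definition is_section (q : nat) (rho : G -> 'rV[R]_q -> 'rV[R]_q)
    (f : B0 -> 'rV[R]_q) : Prop :=
  smooth f /\ forall u b, G0 b -> f (r0 u b) = rho b^-1%g (f u).

(* the action A_0 x E -> E induced by the derivative of rho *)
Definition bullet (q : nat) (rho : G -> 'rV[R]_q -> 'rV[R]_q) (X : g)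
    (v : 'rV[R]_q) : 'rV[R]_q := derive1 (fun t : R => rho (exp (t *: X)) v) 0.

Definition pullback (sigma : B0 -> B) (u : B0) (eta : 'rV[R]_d0) : g :=
  omega (sigma u) (tangent sigma u eta).

(* For i <> 0, the A_i-valued one-form on M induced by the horizontal
   equivariant form sigma^* omega_i: its value on xi in T_{p0 u} M, seen as an
   element of g_i by means of u, is the value of sigma^* omega_i on any lift of
   xi to T_u B0. *)
Definition weyl_form (sigma : B0 -> B) (i : int) (u : B0) (xi : 'rV[R]_m) : g :=
  gr_comp k gr i (pullback sigma u (xget 0 [set eta | tangent p0 u eta = xi])).

Definition hor_lift (sigma : B0 -> B) (u : B0) (xi : 'rV[R]_m) : 'rV[R]_d0 :=
  xget 0 [set eta | tangent p0 u eta = xi /\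
                    gr_comp k gr 0 (pullback sigma u eta) = 0].

(* covariant derivative of the section corresponding to f, for the connection
   induced by the Weyl connection sigma^* omega_0 *)
Definition nabla (sigma : B0 -> B) (q : nat) (f : B0 -> 'rV[R]_q) (u : B0)
    (xi : 'rV[R]_m) : 'rV[R]_q := tangent f u (hor_lift sigma u xi).

End ParabolicGeometry.

(* Multi-indices (j_1, ..., j_k), with j_{a+1} = j a for a : 'I_k.  In all the
   sums ||j|| is at most 2k, so entries bounded by 2k suffice. *)
Notation multi_index k := {ffun 'I_k -> 'I_(k.*2.+1)}.

Section MultiIndex.
Context (R : realType) (n k : nat) (G : lieGroupType 'rV[R]_n).
Implicit Types (j : multi_index k) (Y : 'I_k -> 'rV[R]_n).

Definition mi_weight j : nat := (\sum_(a < k) a.+1 * j a)%N.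

(* (-1)^j / j! *)
Definition mi_coef j : R :=
  (-1) ^+ (\sum_(a < k) j a)%N / (\prod_(a < k) (j a)`!)%N%:R.

(* ad(Y_k)^{j_k} o ... o ad(Y_1)^{j_1}, with Y_{a+1} = Y a *)
Definition mi_ad Y j (X : 'rV[R]_n) : 'rV[R]_n :=
  foldl (fun Z a => iter (j a) (bracket G (Y a)) Z) X (enum 'I_k).

(* sum over l in ls and ||j|| + l = i *)
Definition mi_sum Y (ls : seq int) (X : int -> 'rV[R]_n) (i : int) : 'rV[R]_n :=
  \sum_(l <- ls) \sum_(j : multi_index k | (mi_weight j)%:Z + l == i)
    mi_coef j *: mi_ad Y j (X l).

End MultiIndex.

(* Main.v *)
(* Write sigma' = sigma . E with E = exp(Upsilon_1) ... exp(Upsilon_k).  The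
   Leibniz rule for the right action, together with the equivariance of omega
   and its values on fundamental fields, gives
     sigma'^* omega = Ad(E^-1) sigma^* omega + dlog E,
   where dlog E is the left logarithmic derivative of E.  As the Upsilon_i lie
   in the nilpotent algebra p_+, both terms are polynomial in ad(Upsilon_i):
   Ad(exp(-X)) = sum_t (-ad X)^t / t!, and dlog exp at X is
   sum_t (-ad X)^t / (t+1)!.  Expanding the products over i gives the sums over
   multi-indices, and taking homogeneous components gives (1) and (2).
   The forms sigma^* omega_i and sigma'^* omega_i, i <> 0, do not depend on the
   chosen lift of xi, since two lifts differ by a fundamental vector of some A
   in g_0 and both forms send it to the degree-i component of A; so all of them
   may be evaluated on the sigma-horizontal lift eta.  (That A lies in g_0,
   which is the Lie algebra of G_0, follows from the triviality of the centre.)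
   The sigma'-horizontal lift differs from eta by the fundamental vector of
   minus the degree-0 component of sigma'^* omega (eta), and differentiating an
   equivariant function along it gives (3). *)

From HB Require Import structures.
Require Import Defs.
From mathcomp Require Import all_boot all_order all_algebra.
From mathcomp Require Import zify ring.
From mathcomp Require Import all_classical all_reals all_analysis.

Set Implicit Arguments.
Unset Strict Implicit.
Unset Printing Implicit Defensive.

Import Order.TTheory GRing.Theory Num.Theory.
Import numFieldNormedType.Exports.

Local Open Scope classical_set_scope.
Local Open Scope ring_scope.

(** * Differentiation in normed spaces *)

Section Scale.
Context {R : realType} (V : normedModType R).

(** Registering scaling as bilinear makes the product rule for a scalar function times a vector
    function an instance of the rule for bilinear maps. *)
Lemma scale_is_bilinear :
  bilinear_for
    (GRing.Scale.Law.clone _ _ *:%R _) (GRing.Scale.Law.clone _ _ *:%R _)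
    (@GRing.scale R V : R -> V -> V).
Proof.
split=> [u'|u] a x y /=; first by rewrite scalerDl scalerA.
by rewrite scalerDr !scalerA mulrC.
Qed.

HB.instance Definition _ := bilinear_isBilinear.Build R R V V _ _
  (@GRing.scale R V) scale_is_bilinear.

Lemma scale_differentiable (z : R * V) : differentiable (fun z : R * V => z.1 *: z.2) z.
Proof.
have c : continuous (fun z : R * V => z.1 *: z.2) by exact: scale_continuous.
exact: differentiable_bilin.
Qed.

End Scale.

Section C2.
Context {R : realType}.
Implicit Types V W Z : normedModType R.

Lemma near_eq_diff V W (f g : V -> W) (x : V) :
  (\near x, f x = g x) -> differentiable f x -> 'd f x = 'd g x :> (V -> W).
Proof.
move=> fg df; have dg := near_eq_differentiable fg df.
by apply/funext => v; rewrite -!deriveE//; exact: near_eq_derive.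
Qed.

(* finite dimension, in the form needed to differentiate x |-> 'd f (g x) v *)
Definition has_coordinates V : Prop :=
  exists N (e : 'I_N -> V) (c : 'I_N -> V -> R),
    (forall i v, differentiable (c i) v) /\
    forall v, v = \sum_(i < N) c i v *: e i.

Lemma has_coordinates_rV n : has_coordinates 'rV[R]_n.
Proof.
exists n, (fun i => delta_mx 0 i), (fun i (v : 'rV[R]_n) => v 0 i); split.
  by move=> i v; exact: differentiable_coord.
exact: row_sum_delta.
Qed.

Lemma fst_differentiable V W (z : V * W) : differentiable fst z.
Proof. by apply: linear_differentiable => w; exact: cvg_fst. Qed.

Lemma snd_differentiable V W (z : V * W) : differentiable snd z.
Proof. by apply: linear_differentiable => w; exact: cvg_snd. Qed.

Lemma has_coordinates_prod V W :
  has_coordinates V -> has_coordinates W -> has_coordinates (V * W)%type.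
Proof.
move=> [N [e [c [dc ec]]]] [N' [e' [c' [dc' ec']]]].
exists (N + N')%N,
  (fun i : 'I_(N + N') =>
     match fintype.split i with inl j => (e j, 0) | inr j => (0, e' j) end),
  (fun (i : 'I_(N + N')) z =>
     match fintype.split i with inl j => c j z.1 | inr j => c' j z.2 end); split.
  move=> i v; case: (fintype.split i) => j.
    by apply: (@differentiable_comp _ _ _ _ fst (c j)); [exact: fst_differentiable|].
  by apply: (@differentiable_comp _ _ _ _ snd (c' j)); [exact: snd_differentiable|].
move=> [v w]; rewrite big_split_ord /=.
under eq_bigr do rewrite (unsplitK (inl _)).
under [X in _ + X]eq_bigr do rewrite (unsplitK (inr _)).
rewrite [LHS]surjective_pairing /=; apply/pair_equal_spec; split.
  rewrite raddf_sum/= raddf_sum /= [X in _ + X]big1 ?addr0; last first.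
   by move=> i _ /=; rewrite scaler0.
  exact: ec.
rewrite raddf_sum/= raddf_sum /= [X in X + _]big1 ?add0r; last first.
   by move=> i _ /=; rewrite scaler0.
exact: ec'.
Qed.

(** Just enough regularity to differentiate a tangent map once more, as needed for [bracket] and for
    the derivative of [dlog exp]. Differentiability is asked near x so that the chain rule holds on
    a neighbourhood and can itself be differentiated at x. *)
Definition C2_at V W (f : V -> W) (x : V) : Prop :=
  (\near x, differentiable f x) /\ forall v, differentiable ('D_v f) x.

Lemma C2_at_differentiable V W (f : V -> W) x : C2_at f x -> differentiable f x.
Proof. by case=> /nbhs_singleton. Qed.

Lemma near_eq_C2_at V W (f g : V -> W) x :
  (\near x, f x = g x) -> C2_at f x -> C2_at g x.
Proof.
move=> /near_join fg [df d2f]; split.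
  by near=> y; apply: (@near_eq_differentiable _ _ _ f); near: y.
move=> v; apply: near_eq_differentiable (d2f v).
by near=> y; apply: near_eq_derive; near: y.
Unshelve. all: by end_near. Qed.

Lemma smooth_on_C2_at V W (f : V -> W) (U : set V) x :
  open_nbhs x U -> smooth_on f U -> C2_at f x.
Proof.
move=> [oU Ux] sf; split; last by move=> v; exact: (sf [:: v] x Ux).
near=> y; apply: (sf [::] y); near: y; exact: open_nbhs_nbhs.
Unshelve. all: by end_near. Qed.

(** Near x the derivative of the composite is ['d g (f y)] in the moving direction ['D_v f y].
    Coordinates on W turn this into a finite sum of scalar functions times derivatives of g in fixed
    directions, each differentiable at x. *)
Lemma C2_at_comp V W Z (f : V -> W) (g : W -> Z) x : has_coordinates W ->
  C2_at f x -> C2_at g (f x) -> C2_at (g \o f) x.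
Proof.
move=> [N [e [c [dc ec]]]] [df d2f] [dg d2g].
have cf : {for x, continuous f} by apply: differentiable_continuous; exact: nbhs_singleton df.
have dgf : \forall y \near x, differentiable g (f y) by exact: (cf _ dg).
split; first by near=> y; apply: differentiable_comp; near: y.
move=> v; apply: (@near_eq_differentiable _ _ _
  (\sum_(i < N) (fun y => (c i \o 'D_v f) y *: ('D_(e i) g \o f) y))).
  near=> y; rewrite fct_sumE.
  have dfy : differentiable f y by near: y.
  have dgfy : differentiable g (f y) by near: y.
  rewrite [RHS]deriveE; last exact: differentiable_comp.
  rewrite diff_comp//= -[X in _ = 'd _ _ X]deriveE//.
  rewrite [X in _ = 'd g _ X]ec linear_sum; apply: eq_bigr => i _.
  by rewrite linearZ/= (deriveE _ dgfy).
apply: differentiable_sum => i.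
apply: (@differentiable_comp _ _ (R * Z)%type _ (fun y => (c i ('D_v f y), 'D_(e i) g (f y)))
   (fun z : R * Z => z.1 *: z.2)); last exact: scale_differentiable.
apply: differentiable_pair; first exact: (@differentiable_comp _ _ _ _ ('D_v f) (c i)).
apply: (@differentiable_comp _ _ _ _ f ('D_(e i) g)) => //.
exact: nbhs_singleton df.
Unshelve. all: by end_near. Qed.

Lemma C2_at_pair V W Z (f : V -> W) (g : V -> Z) x :
  C2_at f x -> C2_at g x -> C2_at (fun y => (f y, g y)) x.
Proof.
move=> [df d2f] [dg d2g].
split; first by near=> y; apply: differentiable_pair; near: y.
move=> v; apply: (@near_eq_differentiable _ _ _ (fun y => ('D_v f y, 'D_v g y))).
  near=> y.
  have dfy : differentiable f y by near: y.
  have dgy : differentiable g y by near: y.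
  by rewrite [RHS]deriveE ?diff_pair/= -?deriveE//; exact: differentiable_pair.
exact: differentiable_pair.
Unshelve. all: by end_near. Qed.

Lemma C2_at_linear V W (f : {linear V -> W}) x : continuous f -> C2_at f x.
Proof.
move=> cf; split; first by near=> y; exact: linear_differentiable.
move=> v; apply: (@near_eq_differentiable _ _ _ (cst (f v))); last exact: differentiable_cst.
by near=> y; rewrite deriveE ?diff_lin//; exact: linear_differentiable.
Unshelve. all: by end_near. Qed.

Lemma C2_at_id V (x : V) : C2_at (@idfun V) x.
Proof. by apply: C2_at_linear => y; exact: cvg_id. Qed.

Lemma C2_at_fst V W (z : V * W) : C2_at fst z.
Proof. by apply: C2_at_linear => w; exact: cvg_fst. Qed.

Lemma C2_at_snd V W (z : V * W) : C2_at snd z.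
Proof. by apply: C2_at_linear => w; exact: cvg_snd. Qed.

Lemma C2_at_cst V W (w : W) (x : V) : C2_at (cst w) x.
Proof.
split; first by near=> y; exact: differentiable_cst.
move=> v; apply: (@near_eq_differentiable _ _ _ (cst 0)); last exact: differentiable_cst.
by near=> y; rewrite derive_cst.
Unshelve. all: by end_near. Qed.

End C2.

(** * Tangent maps between manifolds *)

Section ChartNear.
Context {R : realType} {E : normedModType R} {M : topologicalType}.
Variables (c : chart E M) (x : M).
Hypothesis cx : cdom c x.

Lemma chart_img_near : \forall y \near cmap c x, (cmap c @` cdom c) y.
Proof.
by apply: open_nbhs_nbhs; split; [exact: cimg_open|exists x].
Qed.

Lemma cinv_cvg : cinv c y @[y --> cmap c x] --> x.
Proof.
have /cinv_continuous : (cmap c @` cdom c) (cmap c x) by exists x.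
by rewrite /prop_for /continuous_at cmapK.
Qed.

Lemma cmap_cvg : cmap c y @[y --> x] --> cmap c x.
Proof. exact: cmap_continuous. Qed.

Lemma cinvK_near : \forall y \near cmap c x, cmap c (cinv c y) = y.
Proof. by apply: filterS chart_img_near => _ [z cz <-]; rewrite cmapK. Qed.

Lemma cmapK_near : \forall y \near x, cinv c (cmap c y) = y.
Proof.
apply: filterS (open_nbhs_nbhs (conj (@cdom_open _ _ _ c) cx)) => y.
exact: cmapK.
Qed.

End ChartNear.

Section Tangent.
Context {R : realType}.
Implicit Types E F H : normedModType R.

(* tangent f x v, locked because rewriting with terms headed by the coercion
   from {linear _ -> _} triggers very expensive unification problems *)
Fact dmap_key : unit. Proof. exact: tt. Qed.
Definition dmap E F (M : chartedType E) (N : chartedType F) (f : M -> N) x (v : E) : F :=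
  locked_with dmap_key (tangent f x v).

Lemma dmapE E F (M : chartedType E) (N : chartedType F) (f : M -> N) x v :
  dmap f x v = tangent f x v.
Proof. by rewrite /dmap unlock. Qed.

Lemma dmapD E F (M : chartedType E) (N : chartedType F) (f : M -> N) x v w :
  dmap f x (v + w) = dmap f x v + dmap f x w.
Proof. by rewrite !dmapE linearD. Qed.

Lemma dmapZ E F (M : chartedType E) (N : chartedType F) (f : M -> N) x c v :
  dmap f x (c *: v) = c *: dmap f x v.
Proof. by rewrite !dmapE linearZ. Qed.

(** Continuity is a separate clause: [cmap] takes arbitrary values outside the chart domain, so a
    differentiable [chart_rep] alone does not make f continuous. *)
Definition mdiff E F (M : chartedType E) (N : chartedType F) (f : M -> N) x : Prop :=
  {for x, continuous f} /\
  differentiable (chart_rep f x) (cmap (chart_at x) x).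

Definition mC2 E F (M : chartedType E) (N : chartedType F) (f : M -> N) x : Prop :=
  {for x, continuous f} /\ C2_at (chart_rep f x) (cmap (chart_at x) x).

Lemma mC2_mdiff E F (M : chartedType E) (N : chartedType F) (f : M -> N) x :
  mC2 f x -> mdiff f x.
Proof. by case=> cf /C2_at_differentiable. Qed.

Lemma smooth_at_mC2 E F (M : chartedType E) (N : chartedType F) (f : M -> N) x :
  smooth_at f x -> mC2 f x.
Proof. by case=> cf [U Ux sf]; split=> //; exact: smooth_on_C2_at sf. Qed.

Lemma cmap_cinv E (M : chartedType E) (x : M) :
  cinv (chart_at x) (cmap (chart_at x) x) = x.
Proof. by rewrite cmapK//; exact: chart_at_dom. Qed.

Lemma chart_rep_cmap E F (M : chartedType E) (N : chartedType F) (f : M -> N) x :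
  chart_rep f x (cmap (chart_at x) x) = cmap (chart_at (f x)) (f x).
Proof. by rewrite /chart_rep /= cmap_cinv. Qed.

Lemma near_cinv E (M : chartedType E) (x : M) (P : set M) :
  (\forall y \near x, P y) ->
  \forall y \near cmap (chart_at x) x, P (cinv (chart_at x) y).
Proof. by move=> Px; apply: (cinv_cvg (chart_at_dom x)). Qed.

Section Germ.
Context {E F : normedModType R} {M : chartedType E} {N : chartedType F}.
Variables (f g : M -> N) (x : M).
Hypothesis fg : \forall y \near x, f y = g y.

Lemma near_eq_chart_rep :
  \forall y \near cmap (chart_at x) x, chart_rep f x y = chart_rep g x y.
Proof.
by apply: filterS (near_cinv fg) => y; rewrite /chart_rep /= (nbhs_singleton fg) => ->.
Qed.

Lemma near_eq_continuous : {for x, continuous f} -> {for x, continuous g}.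
Proof.
rewrite /prop_for /continuous_at -(nbhs_singleton fg) => cf.
by apply: cvg_trans cf; exact: near_eq_cvg.
Qed.

Lemma near_eq_mdiff : mdiff f x -> mdiff g x.
Proof.
move=> [cf df]; split; first exact: near_eq_continuous.
exact: near_eq_differentiable near_eq_chart_rep df.
Qed.

Lemma near_eq_dmap : mdiff f x -> dmap f x = dmap g x.
Proof.
move=> [cf df]; apply/funext => v; rewrite !dmapE.
by have /(congr1 (fun h => h v)) := near_eq_diff near_eq_chart_rep df.
Qed.

End Germ.

Section Comp.
Context {E F H : normedModType R}.
Context {M : chartedType E} {N : chartedType F} {K : chartedType H}.
Variables (f : M -> N) (g : N -> K) (x : M).

(** The middle chart and its inverse cancel only inside the chart domain, where continuity of f
    keeps the points [f y] for y near x. *)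
Lemma chart_rep_comp : {for x, continuous f} ->
  \forall y \near cmap (chart_at x) x,
    (chart_rep g (f x) \o chart_rep f x) y = chart_rep (g \o f) x y.
Proof.
move=> cf; have := near_cinv (cf _ (cmapK_near (chart_at_dom (f x)))).
by apply: filterS => y; rewrite /chart_rep /= => ->.
Qed.

Lemma mdiff_comp : mdiff f x -> mdiff g (f x) -> mdiff (g \o f) x.
Proof.
move=> [cf df] [cg dg]; split; first exact: continuous_comp.
apply: near_eq_differentiable (chart_rep_comp cf) _.
by apply: differentiable_comp => //; rewrite chart_rep_cmap.
Qed.

Lemma dmap_comp v : mdiff f x -> mdiff g (f x) ->
  dmap (g \o f) x v = dmap g (f x) (dmap f x v).
Proof.
rewrite !dmapE.
move=> [cf df] [cg dg]; rewrite -chart_rep_cmap in dg.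
have := near_eq_diff (chart_rep_comp cf) (differentiable_comp df dg).
rewrite diff_comp// /tangent => /(congr1 (fun h => h v)) /= <-.
by rewrite chart_rep_cmap.
Qed.

(** The base point is known only up to a provable equality, such as [exp 0 = 1]; this form avoids
    rewriting it under tangent maps. *)
Lemma mdiff_comp_at y : f x = y -> mdiff f x -> mdiff g y -> mdiff (g \o f) x.
Proof. by move=> <-; exact: mdiff_comp. Qed.

Lemma dmap_comp_at y v : f x = y -> mdiff f x -> mdiff g y ->
  dmap (g \o f) x v = dmap g y (dmap f x v).
Proof. by move=> <-; exact: dmap_comp. Qed.

Lemma mC2_comp : has_coordinates F -> mC2 f x -> mC2 g (f x) -> mC2 (g \o f) x.
Proof.
move=> hF [cf df] [cg dg]; split; first exact: continuous_comp.
apply: near_eq_C2_at (chart_rep_comp cf) _.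
by apply: C2_at_comp => //; rewrite chart_rep_cmap.
Qed.

End Comp.

Section Basic.
Context {E F : normedModType R} {M : chartedType E} {N : chartedType F}.

Lemma chart_rep_id (x : M) :
  \forall y \near cmap (chart_at x) x, idfun y = chart_rep (@idfun M) x y.
Proof. by apply: filterS (cinvK_near (chart_at_dom x)) => y; rewrite /chart_rep /= => ->. Qed.

Lemma mC2_id (x : M) : mC2 (@idfun M) x.
Proof. by split; [exact: cvg_id|exact: near_eq_C2_at (chart_rep_id x) (C2_at_id _)]. Qed.

Lemma dmap_id (x : M) v : dmap (@idfun M) x v = v.
Proof.
rewrite dmapE /tangent -(near_eq_diff (chart_rep_id x)).
  by rewrite diff_lin// => y; exact: cvg_id.
exact: C2_at_differentiable (C2_at_id _).
Qed.

Lemma mC2_cst (x : M) (y : N) : mC2 (fun=> y) x.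
Proof. by split; [exact: cvg_cst|exact: C2_at_cst]. Qed.

Lemma dmap_cst (x : M) (y : N) v : dmap (fun=> y) x v = 0.
Proof.
by rewrite dmapE /tangent /= (_ : chart_rep _ _ = cst (cmap (chart_at y) y)) ?diff_cst.
Qed.

End Basic.

Section Pair.
Context {E F H : normedModType R}.
Context {M : chartedType E} {N : chartedType F} {K : chartedType H}.
Variables (f : M -> N) (g : M -> K) (x : M).

Lemma mdiff_pair : mdiff f x -> mdiff g x -> mdiff (fun y => (f y, g y)) x.
Proof.
move=> [cf df] [cg dg]; split; first exact: cvg_pair.
exact: differentiable_pair df dg.
Qed.

Lemma mC2_pair : mC2 f x -> mC2 g x -> mC2 (fun y => (f y, g y)) x.
Proof.
move=> [cf df] [cg dg]; split; first exact: cvg_pair.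
exact: C2_at_pair df dg.
Qed.

Lemma dmap_pair v : mdiff f x -> mdiff g x ->
  dmap (fun y => (f y, g y)) x v = (dmap f x v, dmap g x v).
Proof.
rewrite !dmapE.
move=> [cf df] [cg dg]; have := diff_pair df dg.
by move=> /(congr1 (fun h => h v)).
Qed.

End Pair.

Section Partial.
Context {E F H : normedModType R}.
Context {M : chartedType E} {N : chartedType F} {K : chartedType H}.
Implicit Types (f : M * N -> K).

Lemma mC2_left (x : M) (y : N) : mC2 (fun z => (z, y)) x.
Proof. by apply: mC2_pair; [exact: mC2_id|exact: mC2_cst]. Qed.

Lemma mC2_right (x : M) (y : N) : mC2 (fun z => (x, z)) y.
Proof. by apply: mC2_pair; [exact: mC2_cst|exact: mC2_id]. Qed.

Lemma mC2_fst (z : M * N) : mC2 fst z.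
Proof.
split; first exact: cvg_fst.
apply: (@near_eq_C2_at _ _ _ fst); last exact: C2_at_fst.
have cz : \forall y \near (cmap (chart_at z.1) z.1),
    cmap (chart_at z.1) (cinv (chart_at z.1) y) = y.
  exact: cinvK_near (chart_at_dom z.1).
have cp : fst w @[w --> cmap (chart_at z) z] --> cmap (chart_at z.1) z.1 by exact: cvg_fst.
have czw : \forall w \near cmap (chart_at z) z,
    cmap (chart_at z.1) (cinv (chart_at z.1) w.1) = w.1 by exact: (cp _ cz).
by apply: filterS czw => y; rewrite /chart_rep /= => ->.
Qed.

Lemma mC2_snd (z : M * N) : mC2 snd z.
Proof.
split; first exact: cvg_snd.
apply: (@near_eq_C2_at _ _ _ snd); last exact: C2_at_snd.
have cz : \forall y \near (cmap (chart_at z.2) z.2),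
    cmap (chart_at z.2) (cinv (chart_at z.2) y) = y.
  exact: cinvK_near (chart_at_dom z.2).
have cp : snd w @[w --> cmap (chart_at z) z] --> cmap (chart_at z.2) z.2 by exact: cvg_snd.
have czw : \forall w \near cmap (chart_at z) z,
    cmap (chart_at z.2) (cinv (chart_at z.2) w.2) = w.2 by exact: (cp _ cz).
by apply: filterS czw => y; rewrite /chart_rep /= => ->.
Qed.

Lemma mdiff_lpartial f x y : mdiff f (x, y) -> mdiff (fun z => f (z, y)) x.
Proof.
move=> df; apply: (@mdiff_comp _ _ _ _ _ _ (fun z => (z, y)) f) => //.
exact/mC2_mdiff/mC2_left.
Qed.

Lemma mdiff_rpartial f x y : mdiff f (x, y) -> mdiff (fun z => f (x, z)) y.
Proof.
move=> df; apply: (@mdiff_comp _ _ _ _ _ _ (fun z => (x, z)) f) => //.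
exact/mC2_mdiff/mC2_right.
Qed.

Lemma dmap_partials f x y v w : mdiff f (x, y) ->
  dmap f (x, y) (v, w) =
  dmap (fun z => f (z, y)) x v + dmap (fun z => f (x, z)) y w.
Proof.
move=> df.
have := @dmap_comp _ _ _ _ _ _ (fun z => (z, y)) f x v (mC2_mdiff (mC2_left _ _)) df.
have := @dmap_comp _ _ _ _ _ _ (fun z => (x, z)) f y w (mC2_mdiff (mC2_right _ _)) df.
rewrite /comp => -> ->; rewrite !dmap_pair ?dmap_id ?dmap_cst;
  do ?[exact/mC2_mdiff/mC2_cst|exact/mC2_mdiff/mC2_id].
rewrite -dmapD; congr (dmap f _ _).
by apply/pair_equal_spec; rewrite /= addr0 add0r.
Qed.

(** The Leibniz rule: the chain rule through the pair [(f y, h y)], followed by the splitting into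
    partial tangent maps. *)
Lemma dmap_comp2 {D : normedModType R} {L : chartedType D}
    (m : M -> N -> K) (f : L -> M) (h : L -> N) x v :
  mdiff f x -> mdiff h x -> mdiff (fun z => m z.1 z.2) (f x, h x) ->
  dmap (fun y => m (f y) (h y)) x v =
  dmap (fun y => m y (h x)) (f x) (dmap f x v) +
  dmap (fun y => m (f x) y) (h x) (dmap h x v).
Proof.
move=> df dh dm.
have := @dmap_comp _ _ _ _ _ _ (fun y => (f y, h y)) (fun z => m z.1 z.2)
  x v (mdiff_pair df dh) dm.
rewrite dmap_pair// dmap_partials//=.
Qed.

Lemma mdiff_comp2 {D : normedModType R} {L : chartedType D}
    (m : M -> N -> K) (f : L -> M) (h : L -> N) x :
  mdiff f x -> mdiff h x -> mdiff (fun z => m z.1 z.2) (f x, h x) ->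
  mdiff (fun y => m (f y) (h y)) x.
Proof. by move=> df dh; exact: mdiff_comp (mdiff_pair df dh). Qed.

Lemma mC2_comp2 {D : normedModType R} {L : chartedType D}
    (m : M -> N -> K) (f : L -> M) (h : L -> N) x :
  has_coordinates E -> has_coordinates F ->
  mC2 f x -> mC2 h x -> mC2 (fun z => m z.1 z.2) (f x, h x) ->
  mC2 (fun y => m (f y) (h y)) x.
Proof.
by move=> hE hF df dh; apply: mC2_comp (mC2_pair df dh); exact: has_coordinates_prod.
Qed.

End Partial.
End Tangent.

Section LinearMaps.
Context {R : realType}.

Lemma linear_rV_continuous p q (f : {linear 'rV[R]_p -> 'rV[R]_q}) : continuous f.
Proof.
have -> : (f : 'rV[R]_p -> 'rV[R]_q) =
    \sum_(i < p) (fun v : 'rV[R]_p => v 0 i *: f (delta_mx 0 i)).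
  apply/funext => v; rewrite fct_sumE [in LHS](row_sum_delta v) linear_sum.
  by apply: eq_bigr => i _; rewrite linearZ.
move=> v; apply: differentiable_continuous; apply: differentiable_sum => i.
by apply: differentiableZl; exact: differentiable_coord.
Qed.

Context {E : normedModType R} {M : chartedType E}.

Lemma mdiff_linear p q (f : {linear 'rV[R]_p -> 'rV[R]_q}) (x : 'rV[R]_p) : mdiff f x.
Proof.
split; first exact: linear_rV_continuous.
by apply: (@linear_differentiable _ _ _ f); exact: linear_rV_continuous.
Qed.

Lemma dmap_linear p q (f : {linear 'rV[R]_p -> 'rV[R]_q}) (x v : 'rV[R]_p) :
  dmap f x v = f v.
Proof.
rewrite dmapE.
have := diff_lin x (@linear_rV_continuous _ _ f).
by move=> /(congr1 (fun h => h v)).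
Qed.

Lemma dmap_linear_comp p q (f : {linear 'rV[R]_p -> 'rV[R]_q})
    (h : M -> 'rV[R]_p) x v :
  mdiff h x -> dmap (fun y => f (h y)) x v = f (dmap h x v).
Proof.
by move=> dh; rewrite -(dmap_linear f (h x)) -dmap_comp//; exact: mdiff_linear.
Qed.

Lemma dmap_fctD p (f g : M -> 'rV[R]_p) x v : mdiff f x -> mdiff g x ->
  dmap (fun y => f y + g y) x v = dmap f x v + dmap g x v.
Proof.
rewrite !dmapE.
move=> [_ df] [_ dg]; have := diffD df dg.
by move=> /(congr1 (fun h => h v)).
Qed.

End LinearMaps.

Section ParametricTangent.
Context {R : realType} {E F : normedModType R} (n : nat).
Context {M : chartedType E} {N : chartedType F} {K : chartedType 'rV[R]_n}.

(* The basepoint F (a, y) must not depend on a: otherwise the tangent spaces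
   at F (a, y) are identified with 'rV_n by charts that vary discontinuously. *)
Lemma mdiff_dmap_param (f : M * N -> K) (x : M) (y : N) w :
  (forall a b, f (a, y) = f (b, y)) -> mC2 f (x, y) ->
  mdiff (fun a => dmap (fun z => f (a, z)) y w : 'rV[R]_n) x.
Proof.
move=> fy [cf [d1 d2]]; pose c := chart_at x; pose yy := cmap (chart_at y) y.
pose g := chart_rep f (x, y).
have dg : \forall a \near x, differentiable g (cmap c a, yy).
  have : (cmap c a, yy) @[a --> x] --> (cmap c x, yy).
    by apply: cvg_pair; [exact: (cmap_cvg (chart_at_dom x))|exact: cvg_cst].
  by move=> h; exact: (h _ d1).
(* As [f (a, y)] is fixed, the same target chart serves every a, and the tangent maps of all slices
   become directional derivatives of the single chart expression g. *)
have e : \forall a \near x, 'D_((0 : E), w) g (cmap c a, yy) = dmap (fun z => f (a, z)) y w.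
  have ca : \forall a \near x, cdom c a.
    by apply: open_nbhs_nbhs; split; [exact: cdom_open|exact: chart_at_dom].
  near=> a.
  have dga : differentiable g (cmap c a, yy) by near: a.
  have daa : cinv c (cmap c a) = a by apply: cmapK; near: a.
  rewrite deriveE//.
  have rep : chart_rep (fun z => f (a, z)) y = g \o (fun z => (cmap c a, z)).
    by apply/funext => z; rewrite /chart_rep (fy a x) -[in LHS]daa.
  rewrite dmapE /tangent rep -/yy.
  have dr : differentiable (fun z : F => (cmap c a, z)) yy.
    by apply: differentiable_pair; [exact: differentiable_cst|exact: ex_diff].
  rewrite diff_comp//= diff_pair//.
  by rewrite diff_cst diff_val.
have cl : {for cmap c x, continuous (fun a : E => (a, yy))}.
  by apply: cvg_pair; [exact: cvg_id|exact: cvg_cst].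
apply: near_eq_mdiff e _; split.
  apply: (@continuous_comp _ _ _ (fun a => (cmap c a, yy)) ('D_((0 : E), w) g)).
    by apply: cvg_pair; [exact: (cmap_cvg (chart_at_dom x))|exact: cvg_cst].
  by apply: differentiable_continuous; exact: d2.
apply: (@near_eq_differentiable _ _ _ ('D_((0 : E), w) g \o (fun a => (a, yy)))).
  by apply: filterS (cinvK_near (chart_at_dom x)) => a; rewrite /chart_rep /= => ->.
apply: differentiable_comp; last exact: d2.
by apply: differentiable_pair; [exact: ex_diff|exact: differentiable_cst].
Unshelve. all: by end_near. Qed.

End ParametricTangent.

Section Velocity.
Context {R : realType} {n : nat} {F : normedModType R} {N : chartedType F}.

Lemma velocity_line (f : 'rV[R]_n -> N) X : mdiff f 0 ->
  velocity (fun t : R => f (t *: X)) 0 = dmap f 0 X.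
Proof.
rewrite dmapE.
move=> [cf df]; rewrite /velocity scale0r.
have ds : differentiable (fun t : R => t *: X) 0 by exact: ex_diff.
rewrite -[cmap _ \o _]/((chart_rep f 0) \o (fun t : R => t *: X)).
rewrite derive1E'; last by apply: differentiable_comp => //; rewrite scale0r.
rewrite diff_comp//= ?scale0r//; congr ('d _ _ _).
by rewrite diff_val scale1r.
Qed.

End Velocity.

(** * Lie groups and the adjoint action *)

Section LieGroup.
Context {R : realType} {n : nat} {G : lieGroupType 'rV[R]_n}.
Context {E : normedModType R} {M : chartedType E}.
Local Notation g := 'rV[R]_n.
Implicit Types (a b : G) (x : M) (X Y : g).

Lemma mC2_mulg (f h : M -> G) x :
  mC2 f x -> mC2 h x -> mC2 (fun y => (f y * h y)%g) x.
Proof.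
move=> df dh; apply: mC2_comp2 => //; try exact: has_coordinates_rV.
exact/smooth_at_mC2/mulg_smooth.
Qed.

Lemma mC2_invg (f : M -> G) x : mC2 f x -> mC2 (fun y => (f y)^-1%g) x.
Proof.
move=> df; apply: (@mC2_comp _ _ _ _ _ _ _ f (fun z : G => z^-1%g)) => //.
  exact: has_coordinates_rV.
exact/smooth_at_mC2/invg_smooth.
Qed.

Lemma mdiff_mulg (f h : M -> G) x :
  mdiff f x -> mdiff h x -> mdiff (fun y => (f y * h y)%g) x.
Proof.
move=> df dh; apply: mdiff_comp2 => //.
exact/mC2_mdiff/smooth_at_mC2/mulg_smooth.
Qed.

(** With both factors at 1, the translations in the Leibniz rule are identities. *)
Lemma dmap_mulg1 (f h : M -> G) x v : f x = 1%g -> h x = 1%g ->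
  mdiff f x -> mdiff h x ->
  dmap (fun y => (f y * h y)%g) x v = dmap f x v + dmap h x v.
Proof.
move=> f1 h1 df dh.
have dm : mdiff (fun z : G * G => (z.1 * z.2)%g) (f x, h x).
  exact/mC2_mdiff/smooth_at_mC2/mulg_smooth.
rewrite (dmap_comp2 (m := fun a b : G => (a * b)%g))// f1 h1.
have -> : (fun y : G => (y * 1)%g) = idfun by apply/funext => y; rewrite mulg1.
have -> : (fun y : G => (1 * y)%g) = idfun by apply/funext => y; rewrite mul1g.
by congr (_ + _); exact: dmap_id.
Qed.

End LieGroup.

Section Adjoint.
Context {R : realType} {n : nat} {G : lieGroupType 'rV[R]_n}.
Local Notation g := 'rV[R]_n.
Implicit Types (a b : G) (X Y : g).

Lemma mdiff_conj a b : mdiff (fun x : G => (a * x * a^-1)%g) b.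
Proof.
by do 2?apply: mdiff_mulg; apply: mC2_mdiff; do ?[exact: mC2_cst|exact: mC2_id].
Qed.

(* The adjoint actions as matrices acting on row vectors from the right, so that
   Ad_mx reverses products; locked for the same reason as dmap. *)
Fact Ad_mx_key : unit. Proof. exact: tt. Qed.
Definition Ad_mx a : 'M[R]_n := locked_with Ad_mx_key (lin1_mx (Ad a)).

Lemma AdE a X : Ad a X = X *m Ad_mx a.
Proof. by rewrite /Ad_mx unlock mul_rV_lin1. Qed.

Lemma mul_Ad_mx a X : X *m Ad_mx a = dmap (fun x : G => (a * x * a^-1)%g) 1%g X.
Proof. by rewrite -AdE dmapE. Qed.

Lemma dmap_conj {E : normedModType R} {M : chartedType E} (f : M -> G) x v a :
  f x = 1%g -> mdiff f x ->
  dmap (fun y => (a * f y * a^-1)%g) x v = dmap f x v *m Ad_mx a.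
Proof.
move=> f1 df.
rewrite mul_Ad_mx -f1; apply: (@dmap_comp _ _ _ _ _ _ _ f (fun x : G => (a * x * a^-1)%g)) => //.
exact: mdiff_conj.
Qed.

Lemma Ad_mx1 : Ad_mx 1%g = 1%:M.
Proof.
apply/row_matrixP => i; rewrite !rowE mul_Ad_mx mulmx1.
have -> : (fun x : G => (1 * x * 1^-1)%g) = idfun.
  by apply/funext => y; rewrite invg1 mulg1 mul1g.
exact: dmap_id.
Qed.

Lemma Ad_mxM a b : Ad_mx (a * b)%g = Ad_mx b *m Ad_mx a.
Proof.
apply/row_matrixP => i; rewrite !rowE mulmxA [in LHS]mul_Ad_mx.
have -> : (fun x : G => (a * b * x * (a * b)^-1)%g) = (fun x => (a * (b * x * b^-1) * a^-1)%g).
  by apply/funext => x; rewrite invgM !mulgA.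
rewrite dmap_conj; last exact: mdiff_conj.
  by rewrite -mul_Ad_mx.
by rewrite mulg1 mulgV.
Qed.

Lemma Ad_mxVK a : Ad_mx a *m Ad_mx a^-1%g = 1%:M.
Proof. by rewrite -Ad_mxM mulVg Ad_mx1. Qed.

(** Conjugation fixes 1, so [mdiff_dmap_param] applies to it as a map of two variables. *)
Lemma mdiff_Ad Y : mdiff (fun b : G => Y *m Ad_mx b) 1%g.
Proof.
under eq_fun do rewrite mul_Ad_mx.
apply: (@mdiff_dmap_param _ _ _ _ _ _ _ (fun z : G * G => (z.1 * z.2 * z.1^-1)%g)).
  by move=> a b; rewrite !mulg1 !mulgV.
apply: mC2_mulg; first by apply: mC2_mulg; [exact: mC2_fst|exact: mC2_snd].
by apply: mC2_invg; exact: mC2_fst.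
Qed.

Lemma bracketE X Y : bracket G X Y = dmap (fun b : G => Y *m Ad_mx b) 1%g X.
Proof. by rewrite dmapE /bracket; under eq_fun do rewrite AdE. Qed.

Lemma bracket_is_linear X : linear (bracket G X).
Proof.
move=> c Y Z; rewrite !bracketE.
pose sc : {linear g -> g} := ( *:%R c : g -> g).
have -> : (fun b : G => (c *: Y + Z) *m Ad_mx b) =
    (fun b : G => sc (Y *m Ad_mx b) + Z *m Ad_mx b).
  by apply/funext => b; rewrite mulmxDl -scalemxAl.
have dY := mdiff_Ad Y.
rewrite dmap_fctD; last exact: mdiff_Ad.
  by congr (_ + _); exact: (dmap_linear_comp sc).
by apply: (@mdiff_comp _ _ _ _ _ _ _ (fun b : G => Y *m Ad_mx b) sc); [|exact: mdiff_linear].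
Qed.

HB.instance Definition _ X := GRing.isLinear.Build R g g _ (bracket G X) (bracket_is_linear X).

Fact ad_mx_key : unit. Proof. exact: tt. Qed.
Definition ad_mx X : 'M[R]_n := locked_with ad_mx_key (lin1_mx (bracket G X)).

Lemma mul_ad_mx X Y : Y *m ad_mx X = bracket G X Y.
Proof. by rewrite /ad_mx unlock mul_rV_lin1. Qed.

Lemma mul_ad_mxE X Y : Y *m ad_mx X = dmap (fun b : G => Y *m Ad_mx b) 1%g X.
Proof. by rewrite mul_ad_mx bracketE. Qed.

Lemma ad_mx_is_linear : linear ad_mx.
Proof.
move=> c X Y; apply/row_matrixP => i.
by rewrite !rowE mulmxDr -scalemxAr !mul_ad_mxE dmapD dmapZ.
Qed.

HB.instance Definition _ := GRing.isLinear.Build R g 'M[R]_n _ ad_mx ad_mx_is_linear.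

End Adjoint.

(** * The exponential map *)

Section OneVariable.
Context {R : realType}.

Lemma is_derive_diff {V : normedModType R} (f : R -> V) (t : R) (d : V) :
  differentiable f t -> 'd f t 1 = d -> is_derive t 1 f d.
Proof.
move=> df <-; apply: DeriveDef; first exact: diff_derivable.
exact: deriveE.
Qed.

Lemma is_derive_differentiable {V : normedModType R} (f : R -> V) (t : R) (d : V) :
  is_derive t 1 f d -> differentiable f t /\ 'd f t 1 = d.
Proof.
move=> [df <-]; have df' : differentiable f t by apply/derivable1_diffP.
by split=> //; rewrite deriveE.
Qed.

Lemma is_derive_ext {V : normedModType R} (f h : R -> V) (t : R) (d : V) :
  f =1 h -> is_derive t 1 f d -> is_derive t 1 h d.
Proof. by move=> /funext ->. Qed.

Lemma is_derive_scale {V : normedModType R} (k : R -> R) (w : R -> V) (t dk : R) (dw : V) :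
  is_derive t 1 k dk -> is_derive t 1 w dw ->
  is_derive t 1 (fun s => k s *: w s) (dk *: w t + k t *: dw).
Proof.
move=> /is_derive_differentiable[dfk <-] /is_derive_differentiable[dfw <-].
have dp := differentiable_pair dfk dfw.
have ds : differentiable (fun z : R * V => z.1 *: z.2) (k t, w t).
  exact: scale_differentiable.
apply: is_derive_diff; first exact: differentiable_comp dp ds.
have := diff_comp dp ds; rewrite diff_pair//.
rewrite [X in _ = X \o _](_ : _ = (fun z => k t *: z.2 + z.1 *: w t)).
  by move=> /(congr1 (fun h => h 1)) /= ->; rewrite addrC.
have := @diff_bilin _ _ _ _ (@GRing.scale R V : {bilinear R -> V -> V}) (k t, w t).
apply; exact: scale_continuous.
Qed.

Lemma is_derive_linear p q (L : {linear 'rV[R]_p -> 'rV[R]_q}) (f : R -> 'rV[R]_p) (t : R)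
    (d : 'rV[R]_p) :
  is_derive t (1 : R) f d -> is_derive t (1 : R) (fun s => L (f s)) (L d).
Proof.
move=> [df <-].
have cvgL : (L \o (fun h : R => h^-1 *: ((f \o shift t) (h *: (1 : R)) - f t))) h @[h --> 0^']
    --> L ('D_1 f t).
  by apply: continuous_cvg; [exact: linear_rV_continuous|exact: df].
have e : (fun h : R => h^-1 *: (((fun s => L (f s)) \o shift t) (h *: (1 : R)) - L (f t))) =
    L \o (fun h : R => h^-1 *: ((f \o shift t) (h *: (1 : R)) - f t)).
  by apply/funext => h /=; rewrite [in RHS]linearZ [in RHS]linearB.
apply: DeriveDef; first by apply/cvg_ex; exists (L ('D_1 f t)); rewrite e.
by apply/cvg_lim => //; rewrite e.
Qed.

(** Carries a derivative known at 0 to any time t. It serves curves governed by a one-parameter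
    group, whose group law expresses time s through times s - t and t. *)
Lemma is_derive_linear_shift p q (L : {linear 'rV[R]_p -> 'rV[R]_q})
    (f : R -> 'rV[R]_p) (t : R) (d : 'rV[R]_p) :
  is_derive (0 : R) (1 : R) f d -> is_derive t (1 : R) (fun s => L (f (s - t))) (L d).
Proof.
move=> [df <-].
have cvgL : (L \o (fun h : R => h^-1 *: ((f \o shift 0) (h *: (1 : R)) - f 0))) h @[h --> 0^']
    --> L ('D_1 f 0).
  by apply: continuous_cvg; [exact: linear_rV_continuous|exact: df].
have e : (fun h : R => h^-1 *:
      (((fun s => L (f (s - t))) \o shift t) (h *: (1 : R)) - L (f (t - t)))) =
    L \o (fun h : R => h^-1 *: ((f \o shift 0) (h *: (1 : R)) - f 0)).
  by apply/funext => h /=; rewrite addrK addr0 subrr [in RHS]linearZ [in RHS]linearB.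
apply: DeriveDef; first by apply/cvg_ex; exists (L ('D_1 f 0)); rewrite e.
by apply/cvg_lim => //; rewrite e.
Qed.

(** The uniqueness principle behind the series below: curves with equal derivatives that agree at 0
    coincide. *)
Lemma is_derive0_cst p (f : R -> 'rV[R]_p) : (forall t : R, is_derive t (1 : R) f 0) ->
  forall s t, f s = f t.
Proof.
move=> f0 s t; apply/rowP => j.
apply: (@is_derive_0_is_cst R (fun t => f t 0 j)) => r.
have [dr er] := f0 r; apply: DeriveDef.
  by move/derivable_mxP : dr; exact.
by move/matrixP : (derive_mx dr) => /(_ 0 j); rewrite er !mxE.
Qed.

Lemma is_derive_monomial (j : nat) (c t : R) :
  is_derive t (1 : R) (fun s => c * (s ^+ j.+1 / (j.+1)`!%:R)) (c * (t ^+ j / j`!%:R)).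
Proof.
have -> : (fun s => c * (s ^+ j.+1 / (j.+1)`!%:R)) = (c / (j.+1)`!%:R) *: (@idfun R ^+ j.+1).
  by apply/funext => s; rewrite /GRing.scale/= fctE mulrCA mulrC.
have d1 : is_derive t (1 : R) (@idfun R) 1 by exact: is_derive_id.
have d2 := is_deriveX j.+1 d1.
apply: (is_derive_eq (is_deriveZ (c / (j.+1)`!%:R) d2)).
have j0 : j.+1%:R != 0 :> R by rewrite pnatr_eq0.
have j1 : j`!%:R != 0 :> R by rewrite pnatr_eq0 -lt0n fact_gt0.
rewrite /GRing.scale/= factS natrM; field.
by rewrite j1 addrC natr1.
Qed.

End OneVariable.

(** * Left logarithmic derivatives of group-valued maps *)

Section LogDerivative.
Context {R : realType} {n : nat} {G : lieGroupType 'rV[R]_n}.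
Context {E F : normedModType R} {M : chartedType E} {N : chartedType F}.
Implicit Types (f h : M -> G) (x : M) (v : E).

(** The pullback by f of the left Maurer-Cartan form. Translating to 1 before differentiating makes
    the value an element of the Lie algebra. *)
Definition dlog f x v : 'rV[R]_n := dmap (fun y => ((f x)^-1 * f y)%g) x v.

Lemma mdiff_dlog f x : mdiff f x -> mdiff (fun y => ((f x)^-1 * f y)%g) x.
Proof. by move=> df; apply: mdiff_mulg => //; exact/mC2_mdiff/mC2_cst. Qed.

(** The translated product at y factors as the conjugate of f(x)^-1 f(y) by h(x)^-1, times h(x)^-1
    h(y). Both factors are 1 at x, so their derivatives add. *)
Lemma dlog_mulg f h x v : mdiff f x -> mdiff h x ->
  dlog (fun y => (f y * h y)%g) x v =
  dlog f x v *m Ad_mx (h x)^-1%g + dlog h x v.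
Proof.
move=> df dh; have df' := mdiff_dlog df; have dh' := mdiff_dlog dh.
pose u y := ((h x)^-1 * ((f x)^-1 * f y) * ((h x)^-1)^-1)%g.
have du : mdiff u x.
  by apply: (@mdiff_comp _ _ _ _ _ _ _ (fun y => ((f x)^-1 * f y)%g)
     (fun z : G => ((h x)^-1 * z * ((h x)^-1)^-1)%g)) => //; exact: mdiff_conj.
have -> : dlog (fun y => (f y * h y)%g) x v = dmap (fun y => (u y * ((h x)^-1 * h y))%g) x v.
  rewrite /dlog; congr (dmap _ x v); apply/funext => y.
  by rewrite /u invgM invgK !mulgA mulgK.
have e : dmap u x v = dlog f x v *m Ad_mx (h x)^-1%g.
  by apply: dmap_conj => //; rewrite mulVg.
rewrite -e; apply: dmap_mulg1 => //; rewrite /u mulVg//.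
by rewrite mulg1 invgK mulVg.
Qed.

End LogDerivative.

Section LogDerivativeComp.
Context {R : realType} {n : nat} {G : lieGroupType 'rV[R]_n}.
Context {E F : normedModType R} {M : chartedType E} {N : chartedType F}.

Lemma dlog_comp (f : M -> N) (h : N -> G) x v : mdiff f x -> mdiff h (f x) ->
  dlog (h \o f) x v = dlog h (f x) (dmap f x v).
Proof.
move=> df dh; apply: (@dmap_comp _ _ _ _ _ _ _ f (fun y => ((h (f x))^-1 * h y)%g)) => //.
exact: mdiff_dlog.
Qed.

End LogDerivativeComp.

Section Exponential.
Context {R : realType} {n : nat} {G : lieGroupType 'rV[R]_n}.
Variable exp : 'rV[R]_n -> G.
Hypothesis hexp : is_exponential exp.
Local Notation g := 'rV[R]_n.
Local Notation ad := (@ad_mx R n G).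
Implicit Types (X Y : g).

Lemma exponentialD X (s t : R) : exp ((s + t) *: X) = (exp (s *: X) * exp (t *: X))%g.
Proof. exact: exp_addM. Qed.

Lemma exponential0 : exp 0 = 1%g.
Proof.
have := exponentialD 0 0 0; rewrite !scaler0 => /(congr1 (fun a => (a * (exp 0)^-1)%g)).
by rewrite mulgV mulgK => <-.
Qed.

Lemma exponentialN X : exp (- X) = (exp X)^-1%g.
Proof.
have := exponentialD X 1 (- 1); rewrite subrr scale0r exponential0 scale1r scaleN1r.
by move=> e; apply: (mulgI (exp X)); rewrite -e mulgV.
Qed.

Lemma mC2_exp X : mC2 exp X.
Proof. exact/smooth_at_mC2/exp_smooth. Qed.

Lemma mdiff_exp X : mdiff exp X.
Proof. exact/mC2_mdiff/mC2_exp. Qed.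

Lemma dmap_exp0 X : dmap exp 0 X = X.
Proof. by rewrite -velocity_line ?exp_velocity//; exact: mdiff_exp. Qed.

Lemma mdiff_Ad_exp0 Y : mdiff (fun X => Y *m Ad_mx (exp X)) 0.
Proof.
apply: (@mdiff_comp _ _ _ _ _ _ _ exp (fun b => Y *m Ad_mx b)); first exact: mdiff_exp.
by rewrite exponential0; exact: mdiff_Ad.
Qed.

Lemma is_derive_line p (f : g -> 'rV[R]_p) X : mdiff f 0 ->
  is_derive (0 : R) (1 : R) (fun t => f (t *: X)) (dmap f 0 X).
Proof.
move=> df; have dl : differentiable (fun t : R => t *: X) 0 by exact: ex_diff.
have dfl : differentiable f ((0 : R) *: X) by rewrite scale0r; exact: df.2.
apply: DeriveDef.
  by apply/derivable1_diffP; exact: differentiable_comp dl dfl.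
by rewrite -derive1E; exact: (velocity_line X df).
Qed.

Lemma is_derive_Ad_exp0 X Y :
  is_derive (0 : R) (1 : R) (fun t => Y *m Ad_mx (exp (t *: X))) (Y *m ad X).
Proof.
have -> : Y *m ad X = dmap (fun X => Y *m Ad_mx (exp X)) 0 X.
  rewrite (@dmap_comp _ _ _ _ _ _ _ exp (fun b => Y *m Ad_mx b)); last 2 first.
  - exact: mdiff_exp.
  - by rewrite exponential0; exact: mdiff_Ad.
  by rewrite dmap_exp0 exponential0 mul_ad_mxE.
exact: (@is_derive_line _ (fun X => Y *m Ad_mx (exp X))) (mdiff_Ad_exp0 Y).
Qed.

(** The matrix at time s is the product of those at times s - t and t, in either order. Placing the
    factor at s - t first puts [ad X] next to Y; placing it last gives the right-hand version
    below. *)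
Lemma is_derive_Ad_exp_left X Y (t : R) :
  is_derive t (1 : R) (fun t => Y *m Ad_mx (exp (t *: X)))
    (Y *m ad X *m Ad_mx (exp (t *: X))).
Proof.
have := is_derive_linear_shift (mulmxr (Ad_mx (exp (t *: X)))) t (is_derive_Ad_exp0 X Y).
apply: is_derive_ext => s /=.
by rewrite -mulmxA -Ad_mxM -exponentialD addrC subrK.
Qed.

Lemma is_derive_Ad_exp_right X Y (t : R) :
  is_derive t (1 : R) (fun t => Y *m Ad_mx (exp (t *: X)))
    (Y *m Ad_mx (exp (t *: X)) *m ad X).
Proof.
have := is_derive_linear_shift idfun t (is_derive_Ad_exp0 X (Y *m Ad_mx (exp (t *: X)))).
apply: is_derive_ext => s /=.
by rewrite -mulmxA -Ad_mxM -exponentialD subrK.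
Qed.

End Exponential.

Lemma comm_mx_conj {R : comNzRingType} n (A B L : 'M[R]_n) :
  B *m A = 1%:M -> (forall Y : 'rV_n, Y *m A *m L *m B = Y *m L) -> comm_mx L A.
Proof.
move=> BA c; apply/row_matrixP => i.
by rewrite !rowE mulmxA -c -mulmxA BA mulmx1 mulmxA.
Qed.

(** * Finite series for the adjoint action and the logarithmic derivative of the exponential *)

Section ExponentialSeries.
Context {R : realType} {n : nat} {G : lieGroupType 'rV[R]_n}.
Variable exp : 'rV[R]_n -> G.
Hypothesis hexp : is_exponential exp.
Local Notation g := 'rV[R]_n.
Local Notation ad := (@ad_mx R n G).
Implicit Types (X Y : g).

(** Expanding w in the standard basis leaves only products of scalar functions with curves whose
    derivative is known. *)
Lemma is_derive_mul_Ad_exp X (w : R -> g) (t : R) (dw : g) :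
  is_derive t (1 : R) w dw ->
  is_derive t (1 : R) (fun s => w s *m Ad_mx (exp (s *: X)))
    ((dw + w t *m ad X) *m Ad_mx (exp (t *: X))).
Proof.
move=> [dfw ew].
have dwi i : is_derive t (1 : R) (fun s => w s 0 i) (dw 0 i).
  apply: DeriveDef; first by move/derivable_mxP : dfw; exact.
  by move/matrixP : (derive_mx dfw) => /(_ 0 i); rewrite ew !mxE.
have dsum := is_derive_sum (fun i => is_derive_scale (dwi i)
  (is_derive_Ad_exp_left hexp X (delta_mx 0 i) t)).
apply: is_derive_ext (is_derive_eq dsum _) => [s|] /=.
  rewrite fct_sumE [in RHS](row_sum_delta (w s)) mulmx_suml.
  by apply: eq_bigr => i _; rewrite -scalemxAl.
rewrite mulmxDl [in RHS](row_sum_delta dw) [in RHS](row_sum_delta (w t)).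
rewrite !mulmx_suml -big_split; apply: eq_bigr => i _ /=.
by rewrite -!scalemxAl.
Qed.

(** Conjugating L by the one-parameter group gives a curve whose derivative contains the commutator
    of [ad X] and L; the curve is therefore constant, equal to L. *)
Lemma comm_Ad_exp X (L : 'M[R]_n) (t : R) :
  comm_mx L (ad X) -> comm_mx L (Ad_mx (exp (t *: X))).
Proof.
move=> cL; pose A t := Ad_mx (exp (t *: X)); pose B t := Ad_mx (exp (t *: - X)).
have AB s : A s *m B s = 1%:M.
  by rewrite /A /B -Ad_mxM scalerN exponentialN// mulVg Ad_mx1.
have BA s : B s *m A s = 1%:M.
  by rewrite /A /B -Ad_mxM scalerN exponentialN// mulgV Ad_mx1.
have key Y s : is_derive s (1 : R) (fun s => Y *m A s *m L *m B s) 0.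
  have d1 : is_derive s (1 : R) (fun s => Y *m A s *m L) (Y *m A s *m ad X *m L).
    exact: (is_derive_linear (mulmxr L) (is_derive_Ad_exp_right hexp X Y s)).
  apply: is_derive_eq (is_derive_mul_Ad_exp (- X) d1) _.
  have -> : ad (- X) = - ad X by exact: linearN.
  by rewrite mulmxN -(mulmxA _ L) cL mulmxA subrr mul0mx.
have c Y : Y *m A t *m L *m B t = Y *m L.
  rewrite (is_derive0_cst (key Y) t 0) /A /B !scale0r exponential0// Ad_mx1.
  by rewrite !mulmx1.
exact: comm_mx_conj (BA t) c.
Qed.

(** The vector [Y *m ad X] is killed one power earlier, so by induction the derivative of the left
    side is a polynomial, namely the derivative of the right side. Both sides equal Y at t = 0, and
    no convergence question arises. *)
Lemma Ad_exp_nilpotent X Y N (t : R) : Y *m (ad X ^+ N) = 0 ->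
  Y *m Ad_mx (exp (t *: X)) =
  \sum_(j < N) (t ^+ j / j`!%:R) *: (Y *m (ad X ^+ j)).
Proof.
elim: N Y t => [|N IH] Y t.
  by rewrite expr0 mulmx1 big_ord0 => ->; rewrite mul0mx.
rewrite exprS mulmxA => /IH {}IH.
pose f t := Y *m Ad_mx (exp (t *: X)).
pose h t := \sum_(j < N.+1) (t ^+ j / j`!%:R) *: (Y *m (ad X ^+ j)) : g.
have dh s : is_derive s (1 : R) h (Y *m ad X *m Ad_mx (exp (s *: X))).
  rewrite IH.
  have d0 : is_derive s (1 : R) (fun s : R => (s ^+ 0 / 0`!%:R) *: (Y *m (ad X ^+ 0))) 0.
    apply: is_derive_ext (is_derive_cst ((1 / 0`!%:R) *: (Y *m (ad X ^+ 0))) s (1 : R)) => r.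
    by rewrite expr0.
  have dj (j : 'I_N) : is_derive s (1 : R)
      (fun s : R => (s ^+ j.+1 / (j.+1)`!%:R) *: (Y *m (ad X ^+ j.+1)))
      ((s ^+ j / j`!%:R) *: (Y *m ad X *m (ad X ^+ j))).
    have m1 := is_derive_monomial j 1 s.
    have m2 := is_derive_scale m1 (is_derive_cst (Y *m (ad X ^+ j.+1)) s (1 : R)).
    apply: is_derive_ext (is_derive_eq m2 _) => [r|] /=; first by rewrite mul1r.
    by rewrite mul1r scaler0 addr0 exprS mulmxA.
  apply: is_derive_ext (is_derive_eq (is_deriveD d0 (is_derive_sum dj)) _) => [r|].
    by rewrite /h big_ord_recl fctE fct_sumE.
  by rewrite add0r.
have df0 s : is_derive s (1 : R) (f - h) 0.
  by apply: is_derive_eq (is_deriveB (is_derive_Ad_exp_left hexp X Y s) (dh s)) _; rewrite subrr.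
have : (f - h) t = 0.
  rewrite (is_derive0_cst df0 t 0) /f /h !fctE big_ord_recl big1 => [|i _].
    by rewrite expr0 fact0 divr1 scale1r addr0 expr0 scale0r exponential0// Ad_mx1 subrr.
  by rewrite exprS mul0r mul0r scale0r.
by move/eqP; rewrite !fctE subr_eq0 => /eqP.
Qed.

Lemma mdiff_translation X Z : mdiff (fun Z : g => X + Z) Z.
Proof.
have d : differentiable (fun Z : g => X + Z) Z.
  by apply: differentiableD; [exact: differentiable_cst|exact: ex_diff].
by split; [exact: differentiable_continuous|exact: d].
Qed.

Lemma dmap_translation X Z Y : dmap (fun Z : g => X + Z) Z Y = Y.
Proof.
rewrite (dmap_fctD (f := fun=> X) (g := idfun)).
- by rewrite dmap_cst add0r dmap_id.
- exact/mC2_mdiff/mC2_cst.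
- exact/mC2_mdiff/mC2_id.
Qed.

(** Moves the differentiation point from X to the fixed point 0, the form that [mdiff_dmap_param]
    requires. *)
Lemma dlog_exp_translation X Y :
  dlog exp X Y = dmap (fun Z => (exp (- X) * exp (X + Z))%g) 0 Y.
Proof.
pose f Z := ((exp X)^-1 * exp Z)%g.
have e : (fun Z => (exp (- X) * exp (X + Z))%g) = f \o (fun Z => X + Z).
  by apply/funext => Z; rewrite /f /= exponentialN.
have df Z : mdiff f Z by apply: mdiff_mulg; [exact/mC2_mdiff/mC2_cst|exact: mdiff_exp].
have c := @dmap_comp _ _ _ _ _ _ _ (fun Z => X + Z) f 0 Y (mdiff_translation X 0) (df _).
by rewrite e; apply/esym/(etrans c); rewrite dmap_translation addr0.
Qed.

Lemma mdiff_dlog_exp Y : mdiff (fun X => dlog exp X Y) 0.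
Proof.
have -> : (fun X => dlog exp X Y) = (fun X => dmap (fun Z => (exp (- X) * exp (X + Z))%g) 0 Y).
  by apply/funext => X; exact: dlog_exp_translation.
have cadd (z : g * g) : mC2 (fun z : g * g => z.1 + z.2) z.
  split; first exact: add_continuous.
  pose L : {linear (g * g)%type -> g} := (fst \+ snd).
  by apply: (@C2_at_linear _ _ _ L) => w; exact: add_continuous.
have copp (z : g * g) : mC2 (fun z : g * g => - z.1) z.
  split.
    by apply: continuous_comp; [exact: cvg_fst|exact: opp_continuous].
  pose L : {linear (g * g)%type -> g} := (-%R \o fst).
  apply: (@C2_at_linear _ _ _ L) => w.
  by apply: continuous_comp; [exact: cvg_fst|exact: opp_continuous].
apply: (@mdiff_dmap_param _ _ _ _ _ _ _ (fun z : g * g => (exp (- z.1) * exp (z.1 + z.2))%g)).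
  by move=> a b; rewrite /= !addr0 !exponentialN// !mulVg.
have hg : has_coordinates g by exact: has_coordinates_rV.
by apply: mC2_mulg; apply: mC2_comp => //; exact: mC2_exp.
Qed.

Lemma dlog_exp0 Y : dlog exp 0 Y = Y.
Proof.
rewrite /dlog exponential0// (_ : (fun _ => _) = exp) ?dmap_exp0//.
by apply/funext => X; rewrite invg1 mul1g.
Qed.

Lemma dlog_exp_scale X Y (s : R) :
  dlog (fun X => exp (s *: X)) X Y = s *: dlog exp (s *: X) Y.
Proof.
pose sc : {linear g -> g} := ( *:%R s : g -> g).
have := @dlog_comp _ _ _ _ _ _ _ (sc : g -> g) exp X Y (mdiff_linear sc X) (mdiff_exp hexp _).
by move=> ->; rewrite dmap_linear /dlog dmapZ.
Qed.

(* s |-> s dlog exp (s X) Y is a cocycle over the one-parameter group of X, hence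
   determined by its derivative Y at 0; arguing through the group law avoids the
   symmetry of second derivatives. *)
Lemma is_derive_dlog_exp X Y (s : R) :
  is_derive s (1 : R) (fun s => s *: dlog exp (s *: X) Y)
    (Y *m Ad_mx (exp (- s *: X))).
Proof.
(* At 0 the scalar factor kills the derivative of [dlog exp], of which only the existence
   matters. *)
have d0 : is_derive (0 : R) (1 : R) (fun h => h *: dlog exp (h *: X) Y) Y.
  have d := is_derive_scale (is_derive_id (0 : R) (1 : R)) (is_derive_line X (mdiff_dlog_exp Y)).
  apply: is_derive_ext (is_derive_eq d _) => [t|] //.
  by rewrite !scale0r scale1r addr0 dlog_exp0.
have d1 := is_derive_linear_shift (mulmxr (Ad_mx (exp (- s *: X)))) s d0.
have d2 := is_deriveD d1 (is_derive_cst (s *: dlog exp (s *: X) Y) s (1 : R)).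
apply: is_derive_ext (is_derive_eq d2 (addr0 _)) => t; rewrite fctE.
have ds r : mdiff (fun X => exp (r *: X)) X.
  apply: (@mdiff_comp _ _ _ _ _ _ _ ( *:%R r : g -> g) exp); last exact: mdiff_exp.
  pose sc : {linear g -> g} := ( *:%R r : g -> g).
  exact: (mdiff_linear sc).
have eV : exp (- s *: X) = (exp (s *: X))^-1%g by rewrite scaleNr exponentialN.
have F : (fun Z => (exp ((t - s) *: Z) * exp (s *: Z))%g) = (fun Z => exp (t *: Z)).
  by apply/funext => Z; rewrite -exponentialD// subrK.
(* With c(t) = t dlog exp (t X) Y, this is the cocycle identity: c(t) is c(t - s) acted on by the
   inverse of Ad(exp(s X)), plus c(s). *)
have e := dlog_mulg Y (ds (t - s)) (ds s).
rewrite /= /cst eV.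
exact: etrans (f_equal2 (fun u v => u *m _ + v) (esym (dlog_exp_scale X Y (t - s)))
   (esym (dlog_exp_scale X Y s)))
  (etrans (esym e) (etrans (congr1 (fun f => dlog f X Y) F) (dlog_exp_scale X Y t))).
Qed.

(** Integrates the finite series of Ad(exp(-s X)) from 0 to 1 term by term; integrating s^j / j!
    produces the factorial of j + 1. *)
Lemma dlog_exp_nilpotent X Y N : Y *m (ad X ^+ N) = 0 ->
  dlog exp X Y = \sum_(j < N) ((-1) ^+ j / (j.+1)`!%:R) *: (Y *m (ad X ^+ j)).
Proof.
move=> nilY.
pose h s := \sum_(j < N) (((-1) ^+ j * (s ^+ j.+1 / (j.+1)`!%:R)) *: (Y *m (ad X ^+ j))) : g.
pose f s := s *: dlog exp (s *: X) Y.
have dj s (j : 'I_N) : is_derive s (1 : R)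
    (fun s : R => ((-1) ^+ j * (s ^+ j.+1 / (j.+1)`!%:R)) *: (Y *m (ad X ^+ j)))
    (((- s) ^+ j / j`!%:R) *: (Y *m (ad X ^+ j))).
  have m1 := is_derive_monomial j ((-1) ^+ j) s.
  have m2 := is_derive_scale m1 (is_derive_cst (Y *m (ad X ^+ j)) s (1 : R)).
  apply: is_derive_eq m2 _.
  by rewrite scaler0 addr0 [in RHS]exprNn mulrA.
have dh s : is_derive s (1 : R) h (Y *m Ad_mx (exp (- s *: X))).
  rewrite (Ad_exp_nilpotent _ nilY).
  by apply: is_derive_ext (is_derive_sum (dj s)) => r; rewrite /h fct_sumE.
have df0 s : is_derive s (1 : R) (f - h) 0.
  by apply: is_derive_eq (is_deriveB (is_derive_dlog_exp X Y s) (dh s)) _; rewrite subrr.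
have : (f - h) 1 = 0.
  rewrite (is_derive0_cst df0 1 0) /f /h !fctE big1 => [|i _].
    by rewrite scale0r subrr.
  by rewrite exprS mul0r mul0r mulr0 scale0r.
move/eqP; rewrite !fctE subr_eq0 => /eqP; rewrite /f /h !scale1r => ->.
by apply: eq_bigr => j _; rewrite expr1n mul1r.
Qed.

End ExponentialSeries.

(** * Gradings and their subgroups *)

(** An injective map of V into itself is onto by dimension. This gives closure under inverses for
    [parabolic] and [levi], which are defined by inclusions in one direction. *)
Lemma mulmx_stable_inv {F : fieldType} n (V : {vspace 'rV[F]_n}) (A B : 'M[F]_n) :
  A *m B = 1%:M -> (forall X, X \in V -> X *m A \in V) ->
  forall X, X \in V -> X *m B \in V.
Proof.
move=> AB AV X XV; pose f := linfun (mulmxr A : 'rV[F]_n -> 'rV[F]_n).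
have fE Y : f Y = Y *m A by exact: lfunE.
have fV : (f @: V <= V)%VS.
  by apply/subvP => _ /memv_imgP[Y YV ->]; rewrite fE; exact: AV.
have injf : lker f = 0%VS.
  apply/eqP/lker0P => Y Z; rewrite !fE => /(congr1 (mulmx^~ B)) /=.
  by rewrite -!mulmxA AB !mulmx1.
have fVE : (f @: V = V)%VS.
  apply/eqP; rewrite eqEdim fV /=.
  have -> : \dim (f @: V) = \dim V by apply: limg_dim_eq; rewrite injf capv0.
  exact: leqnn.
move: XV; rewrite -{1}fVE => /memv_imgP[Y YV ->].
by rewrite fE -mulmxA AB mulmx1.
Qed.

Section Grading.
Context {R : realType} {n : nat} {G : lieGroupType 'rV[R]_n} {k : nat}.
Context {gr : int -> {vspace 'rV[R]_n}}.
Hypothesis hgr : is_grading G k gr.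
Local Notation g := 'rV[R]_n.
Local Notation ad := (@ad_mx R n G).
Local Notation gcomp := (gr_comp k gr).
Local Notation filt := (gr_filt k gr).
Implicit Types (X Y Z : g) (i j l : int).

Lemma mem_degrees i : (i \in degrees k) = (- k%:Z <= i <= k%:Z).
Proof.
apply/mapP/idP => [[j]|ik]; first by rewrite mem_iota => jk ->; lia.
exists (absz (i + k%:Z)); last by lia.
by rewrite mem_iota; lia.
Qed.

Lemma degrees_uniq : uniq (degrees k).
Proof. by rewrite map_inj_uniq ?iota_uniq// => i j; lia. Qed.

Lemma sumv_seq_subP (I : eqType) (s : seq I) (P : pred I) (V : I -> {vspace g})
    (U : {vspace g}) :
  (forall i : I, i \in s -> P i -> (V i <= U)%VS) -> (\sum_(i <- s | P i) V i <= U)%VS.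
Proof.
move=> VU; rewrite big_seq_cond; elim/big_ind: _ => [|W W' hW hW'|i /andP[]].
- exact: sub0v.
- by rewrite subv_add hW.
- exact: VU.
Qed.

Lemma gr_sub_sum i (P : pred int) : i \in degrees k -> P i ->
  (gr i <= \sum_(j <- degrees k | P j) gr j)%VS.
Proof.
by move=> ik Pi; rewrite big_mkcond (bigD1_seq i ik degrees_uniq)/= Pi addvSl.
Qed.

Lemma gr_ind (U : {vspace g}) : (forall i X, X \in gr i -> X \in U) -> forall X, X \in U.
Proof.
move=> grU X; have : X \in (\sum_(i <- degrees k) gr i)%VS by rewrite (gr_sum hgr) memvf.
by apply: subvP; apply: sumv_seq_subP => i _ _; apply/subvP => Y; exact: grU.
Qed.

(** Directness says that the dimension of the total sum is the sum of the dimensions. The other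
    pieces together have at most the sum of their dimensions, so the dimension formula leaves none
    for the intersection. *)
Lemma gr_cap0 i : (gr i :&: \sum_(j <- degrees k | j != i) gr j = 0)%VS.
Proof.
have [ik|/(gr_out hgr) ->] := boolP (i \in degrees k); last exact: cap0v.
have := gr_direct hgr; rewrite directvE /= (bigD1_seq i ik degrees_uniq)/=.
rewrite [X in _ == X](bigD1_seq i ik degrees_uniq)/= => /eqP dims.
have := dimv_sum_cap (gr i) (\sum_(j <- degrees k | j != i) gr j).
rewrite dims => cap; apply/eqP; rewrite -dimv_eq0 -leqn0.
have : (\dim (\sum_(j <- degrees k | j != i) gr j) <=
    \sum_(j <- degrees k | j != i) \dim (gr j))%N.
  elim/big_ind2: _ => [|W a W' b Wa Wb|//]; first by rewrite dimv0.
  by apply: leq_trans (dimv_add_leqif _ _) _; exact: leq_add.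
by move: cap; set a := (X in (X <= _)%N); lia.
Qed.

Lemma gr_comp_mem i X : gcomp i X \in gr i.
Proof. exact: memv_pi. Qed.

Lemma gr_comp_id i X : X \in gr i -> gcomp i X = X.
Proof. by apply: daddv_pi_id; exact: gr_cap0. Qed.

Lemma gr_comp_eq0 i j X : X \in gr j -> j != i -> gcomp i X = 0.
Proof.
move=> Xj ji; have [jk|/(gr_out hgr) jk] := boolP (j \in degrees k); last first.
  by move: Xj; rewrite jk memv0 => /eqP ->; rewrite linear0.
have XW : X \in (\sum_(j <- degrees k | j != i) gr j)%VS.
  by apply: subvP Xj; exact: gr_sub_sum.
have e : daddv_pi (\sum_(j <- degrees k | j != i) gr j) (gr i) X = X.
  by apply: daddv_pi_id => //; rewrite capvC; exact: gr_cap0.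
apply: (addIr X); rewrite add0r.
exact: etrans (congr1 (fun Z => gcomp i X + Z) (esym e))
  (daddv_pi_add (gr_cap0 i) (subvP (addvSr (gr i) _) _ XW)).
Qed.

Lemma gr_comp_delta i j X : X \in gr j -> gcomp i X = if j == i then X else 0.
Proof.
by move=> Xj; case: eqVneq => [<-|ji]; [exact: gr_comp_id|exact: gr_comp_eq0 Xj ji].
Qed.

Lemma linear_gr_ext (V : vectType R) (f h : {linear g -> V}) :
  (forall i X, X \in gr i -> f X = h X) -> f =1 h.
Proof.
move=> fh X; have : X \in lker (linfun f - linfun h).
  move: X; apply: gr_ind => i X /fh e.
  by rewrite memv_ker add_lfunE opp_lfunE !lfunE e subrr.
by rewrite memv_ker add_lfunE opp_lfunE !lfunE subr_eq0 => /eqP.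
Qed.

Lemma sum_gr_comp X : \sum_(i <- degrees k) gcomp i X = X.
Proof.
pose S : 'End(g) := \sum_(i <- degrees k) gcomp i.
have SE Y : S Y = \sum_(i <- degrees k) gcomp i Y by exact: sum_lfunE.
rewrite -SE; move: X; apply: (@linear_gr_ext _ S idfun) => i Y Yi; apply: (etrans (SE Y)).
have [ik|/(gr_out hgr) i0] := boolP (i \in degrees k); last first.
  by move: Yi; rewrite i0 memv0 => /eqP ->; rewrite big1// => j _; rewrite linear0.
rewrite (bigD1_seq i ik degrees_uniq)/= gr_comp_id// big1 ?addr0// => j ji.
by apply: gr_comp_eq0 Yi _; rewrite eq_sym.
Qed.

Lemma gr_filt_sub i j : j <= i -> (gr i <= filt j)%VS.
Proof.
move=> ji; have [ik|/(gr_out hgr) ->] := boolP (i \in degrees k); last exact: sub0v.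
exact: gr_sub_sum.
Qed.

Lemma mem_gr_filtP j X : reflect (forall i, i < j -> gcomp i X = 0) (X \in filt j).
Proof.
apply: (iffP idP) => [Xj i ij|X0].
  have : X \in lker (gcomp i).
    apply: subvP Xj; apply: sumv_seq_subP => l _ jl; apply/subvP => Y Yl.
    by rewrite memv_ker (gr_comp_eq0 Yl)//; lia.
  by rewrite memv_ker => /eqP.
rewrite -(sum_gr_comp X); apply: memv_suml => i _.
have [ji|ij] := lerP j i; last by rewrite X0// mem0v.
by apply: subvP (gr_comp_mem i X); exact: gr_filt_sub.
Qed.

Lemma gr_filt_le i j X : i <= j -> X \in filt j -> X \in filt i.
Proof.
by move=> ij /mem_gr_filtP X0; apply/mem_gr_filtP => l li; apply: X0; lia.
Qed.

Lemma gr_filt_full X : X \in filt (- k%:Z).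
Proof.
apply/mem_gr_filtP => i ik; have := gr_comp_mem i X.
by rewrite (gr_out hgr) ?memv0 => [/eqP//|]; rewrite mem_degrees; lia.
Qed.

Lemma gr_filt_out X : X \in filt (k%:Z + 1) -> X = 0.
Proof.
move=> /mem_gr_filtP X0; rewrite -(sum_gr_comp X) big_seq big1// => i.
by rewrite mem_degrees => ik; apply: X0; lia.
Qed.

Lemma gr_ad i j X Y : X \in gr i -> Y \in gr j -> Y *m ad X \in gr (i + j).
Proof. by rewrite mul_ad_mx; exact: (gr_bracket hgr). Qed.

Lemma gr_filt_ad i j X Y : X \in filt i -> Y \in filt j -> Y *m ad X \in filt (i + j).
Proof.
move=> /mem_gr_filtP Xi /mem_gr_filtP Yj.
rewrite -(sum_gr_comp X) -(sum_gr_comp Y) mulmx_suml; apply: memv_suml => b _.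
rewrite linear_sum mulmx_sumr; apply: memv_suml => a _.
have [ia|ai] := lerP i a; last by rewrite Xi// linear0 mulmx0 mem0v.
have [jb|bj] := lerP j b; last by rewrite Yj// mul0mx mem0v.
apply: (subvP (@gr_filt_sub (a + b) _ _)); first exact: lerD.
by apply: gr_ad; exact: gr_comp_mem.
Qed.

Lemma gr_filt_adX i X Y (N : nat) : X \in filt 1 -> Y \in filt i ->
  Y *m ad X ^+ N \in filt (i + N%:Z).
Proof.
move=> X1 Yi; elim: N => [|N IH]; first by rewrite expr0 mulmx1 addr0.
rewrite exprSr mulmxA.
have -> : i + N.+1%:Z = 1 + (i + N%:Z) by lia.
exact: gr_filt_ad.
Qed.

(** Each [ad X] raises the filtration degree by at least one, and 2k + 1 steps lead from -k past
    k. *)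
Lemma ad_nilpotent X Y : X \in filt 1 -> Y *m ad X ^+ k.*2.+1 = 0.
Proof.
move=> X1; apply: gr_filt_out.
have -> : k%:Z + 1 = - k%:Z + k.*2.+1%:Z by lia.
by apply: gr_filt_adX => //; exact: gr_filt_full.
Qed.

(** * The subgroups P and G_0 and their Lie algebras *)

Section Subgroups.
Variable exp : g -> G.
Hypothesis hexp : is_exponential exp.
Hypothesis hss : semisimple G.
Local Notation P := (@parabolic R n G k gr).
Local Notation G0 := (@levi R n G gr).

Lemma exp_parabolic Z (t : R) : Z \in filt 1 -> P (exp (t *: Z)).
Proof.
move=> Z1 j X Xj; rewrite AdE (Ad_exp_nilpotent hexp t (ad_nilpotent X Z1)).
apply: memv_suml => i _; apply: memvZ.
by apply: (@gr_filt_le j (j + i%:Z)); [lia|exact: gr_filt_adX].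
Qed.

Lemma exp_levi A (t : R) : A \in gr 0 -> G0 (exp (t *: A)).
Proof.
move=> A0 i X Xi; rewrite AdE.
have cL : comm_mx (lin1_mx (gcomp i)) (ad A).
  apply/row_matrixP => r; rewrite !rowE !mulmxA !mul_rV_lin1.
  apply: (@linear_gr_ext _ (mulmxr (ad A) \o gcomp i) (gcomp i \o mulmxr (ad A))) => j Y Yj /=.
  rewrite (gr_comp_delta _ Yj) (gr_comp_delta _ (gr_ad A0 Yj)) add0r.
  by case: eqP => // _; rewrite mul0mx.
have := congr1 (fun L => X *m L) (comm_Ad_exp hexp t cL).
rewrite /= !mulmxA !mul_rV_lin1 /= gr_comp_id// => ->.
exact: gr_comp_mem.
Qed.

Lemma levi_parabolic (a : G) : G0 a -> P a.
Proof.
move=> Ga j X /mem_gr_filtP X0; rewrite -(sum_gr_comp X) linear_sum.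
apply: memv_suml => i _; have [ji|ij] := lerP j i.
  by apply: subvP (Ga i _ (gr_comp_mem i X)); exact: gr_filt_sub.
by rewrite X0// linear0 mem0v.
Qed.

Lemma Ad_stable_inv (V : {vspace g}) (a : G) :
  (forall X, X \in V -> Ad a X \in V) -> forall X, X \in V -> Ad a^-1%g X \in V.
Proof.
move=> aV X; rewrite AdE; apply: mulmx_stable_inv (Ad_mxVK a) _ X => X XV.
by rewrite -AdE; exact: aV.
Qed.

Lemma parabolicV (a : G) : P a -> P a^-1%g.
Proof. by move=> Pa j; apply: Ad_stable_inv; exact: Pa. Qed.

Lemma leviV (a : G) : G0 a -> G0 a^-1%g.
Proof. by move=> Pa j; apply: Ad_stable_inv; exact: Pa. Qed.

Lemma parabolicM (a b : G) : P a -> P b -> P (a * b)%g.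
Proof. by move=> Pa Pb j X Xj; rewrite AdE Ad_mxM mulmxA -!AdE; exact/Pa/Pb. Qed.

Lemma leviM (a b : G) : G0 a -> G0 b -> G0 (a * b)%g.
Proof. by move=> Pa Pb j X Xj; rewrite AdE Ad_mxM mulmxA -!AdE; exact/Pa/Pb. Qed.

Lemma levi1 : G0 1%g.
Proof. by move=> i X Xi; rewrite AdE Ad_mx1 mulmx1. Qed.

Lemma parabolic1 : P 1%g.
Proof. exact/levi_parabolic/levi1. Qed.

Lemma parabolic_prod (I : Type) (s : seq I) (f : I -> G) :
  (forall c : I, P (f c)) -> P (\big[*%g/1%g]_(i <- s) f i).
Proof. move=> Pf; elim: s => [|c s IH]; first by rewrite big_nil; exact: parabolic1.
by rewrite big_cons; exact: parabolicM (Pf c) IH. Qed.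

(* exp (t X) centralizes the one-parameter group of X *)
Lemma ad_self X : X *m ad X = 0.
Proof.
have XA t : X *m Ad_mx (exp (t *: X)) = X.
  pose f Z := (exp (t *: X) * exp Z * (exp (t *: X))^-1)%g.
  have df : mdiff f 0.
    apply: (@mdiff_comp _ _ _ _ _ _ _ exp
      (fun b : G => (exp (t *: X) * b * (exp (t *: X))^-1)%g)).
      exact: mdiff_exp.
    exact: mdiff_conj.
  have e1 : dmap f 0 X = X *m Ad_mx (exp (t *: X)).
    apply: etrans (dmap_conj _ _ (exponential0 hexp) (mdiff_exp hexp 0)) _.
    by rewrite dmap_exp0.
  rewrite -e1 -velocity_line// -[RHS](exp_velocity hexp X).
  congr (velocity _ 0); apply/funext => s; rewrite /f -exponentialN//.
  rewrite -scaleNr -!exponentialD//; congr (exp (_ *: X)); ring.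
have [_ <-] := is_derive_Ad_exp0 hexp X X.
rewrite (_ : (fun t => _) = cst X); last by apply/funext.
exact: derive_cst.
Qed.

(** Polarization of [ad_self]. *)
Lemma bracket_anti X Y : Y *m ad X = - (X *m ad Y).
Proof.
have := ad_self (X + Y); rewrite linearD/= mulmxDl !mulmxDr !ad_self add0r addr0.
by rewrite addrC => /eqP; rewrite addr_eq0 => /eqP.
Qed.

(** The line through a central element is an ideal whose derived algebra is zero, so semisimplicity
    makes it trivial. *)
Lemma center_trivial C : (forall Y, Y *m ad C = 0) -> C = 0.
Proof.
move=> C0; have adC X : C *m ad X = 0 by rewrite bracket_anti C0 oppr0.
have Iid : is_ideal G <[C]>%VS.
  move=> X _ /vlineP[c ->]; rewrite -mul_ad_mx -scalemxAl adC scaler0.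
  exact: mem0v.
have dI : derived G <[C]>%VS = 0%VS.
  apply/eqP; rewrite -subv0; apply/span_subvP => _ /allpairsP[[X Y] /= [XI YI ->]].
  have /vlineP[c ->] := vbasis_mem YI.
  by rewrite -mul_ad_mx -scalemxAl adC scaler0 mem0v.
have := hss Iid (ex_intro _ 1%N dI) => I0.
by apply/eqP; rewrite -memv0 -I0 memv_line.
Qed.

(** On [gr i] the degree-l component of A acts as the degree l + i component of [ad A], which
    vanishes for nonzero l as [ad A] preserves [gr i]. That component is thus central, hence
    zero. *)
Lemma gr0_stabilizer A :
  (forall i X, X \in gr i -> X *m ad A \in gr i) -> A \in gr 0.
Proof.
move=> Agr; have key l : l != 0 -> gcomp l A = 0.
  move=> l0; apply: center_trivial.
  apply: (@linear_gr_ext _ (mulmxr (ad (gcomp l A))) \0) => i X Xi /=.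
  have e : gcomp (l + i) (X *m ad A) = X *m ad (gcomp l A).
    apply: (@linear_gr_ext _ (gcomp (l + i) \o (mulmx X \o ad)) (mulmx X \o (ad \o gcomp l))).
    move=> j Y Yj /=; rewrite (gr_comp_delta _ Yj) (gr_comp_delta _ (gr_ad Yj Xi)).
    rewrite (inj_eq (addIr i)); case: eqP => // _.
    by rewrite linear0 mulmx0.
  rewrite -e; apply: gr_comp_eq0 (Agr _ _ Xi) _.
  by apply: contra l0 => /eqP li; rewrite -(addrK i l) -li subrr.
rewrite -(sum_gr_comp A); apply: memv_suml => l _.
have [->|l0] := eqVneq l 0; first exact: gr_comp_mem.
by rewrite key// mem0v.
Qed.

End Subgroups.

End Grading.

(** * Smooth actions and their orbits *)

Lemma near_eq_velocity {R : realType} {E : normedModType R} {M : chartedType E}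
    (c c' : R -> M) (t : R) :
  (\forall s \near t, c s = c' s) -> velocity c t = velocity c' t.
Proof.
move=> cc'; rewrite /velocity !derive1E (nbhs_singleton cc').
by apply: near_eq_derive; apply: filterS cc' => s /= ->.
Qed.

Section Action.
Context {R : realType} {n : nat} {G : lieGroupType 'rV[R]_n}.
Context {F : normedModType R} {B : chartedType F} {H : set G} {r : B -> G -> B}.
Hypothesis r1 : forall u, r u 1%g = u.
Hypothesis rM : forall u a b, H a -> H b -> r (r u a) b = r u (a * b)%g.
Hypothesis r_smooth : smooth_within [set z : B * G | H z.2] (fun z => r z.1 z.2).
Variable exp : 'rV[R]_n -> G.
Hypothesis hexp : is_exponential exp.

Section Family.
Context {E : normedModType R} {N : chartedType E}.
Variables (f : N -> B) (e : N -> G) (x : N).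
Hypotheses (df : mdiff f x) (de : mdiff e x).
Hypothesis eH : \forall y \near x, H (e y).

(** The action is smooth only within B x H. Near the base point it is the restriction of a smooth
    [gg], and since e stays in H the composite is unchanged when r is replaced by [gg]. *)
Lemma mdiff_act : mdiff (fun y => r (f y) (e y)) x.
Proof.
have [gg sgg egg] := r_smooth (nbhs_singleton eH : [set z : B * G | H z.2] (f x, e x)).
have dgg := mC2_mdiff (smooth_at_mC2 sgg).
have dfe := mdiff_pair df de.
apply: near_eq_mdiff (mdiff_comp dfe dgg).
have n1 : \forall y \near x, H (e y) -> gg (f y, e y) = r (f y) (e y).
  exact: (dfe.1 _ egg).
by apply: filterS2 n1 eH => y h1 h2 /=; rewrite h1.
Qed.

(** The Leibniz rule holds for the smooth extension [gg]; the germs [n1], [n2] and [n3] bring each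
    of its three terms back to r. *)
Lemma dmap_act v : dmap (fun y => r (f y) (e y)) x v =
  dmap (fun b => r b (e x)) (f x) (dmap f x v) + dmap (fun y => r (f x) (e y)) x v.
Proof.
have eHx := nbhs_singleton eH.
have [gg sgg egg] := r_smooth (eHx : [set z : B * G | H z.2] (f x, e x)).
have dgg := mC2_mdiff (smooth_at_mC2 sgg).
have dfe := mdiff_pair df de.
have dce : mdiff (fun y => (f x, e y)) x by apply: mdiff_pair => //; exact/mC2_mdiff/mC2_cst.
have n1 : \forall y \near x, gg (f y, e y) = r (f y) (e y).
  have n1 : \forall y \near x, H (e y) -> gg (f y, e y) = r (f y) (e y).
    exact: (dfe.1 _ egg).
  by apply: filterS2 n1 eH => y h1 h2 /=; rewrite h1.
have n2 : \forall y \near x, gg (f x, e y) = r (f x) (e y).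
  have n2 : \forall y \near x, H (e y) -> gg (f x, e y) = r (f x) (e y).
    exact: (dce.1 _ egg).
  by apply: filterS2 n2 eH => y h1 h2 /=; rewrite h1.
have n3 : \forall b \near f x, gg (b, e x) = r b (e x).
  have dl := mC2_mdiff (mC2_left (f x) (e x)).
  have n3 : \forall b \near f x, H (e x) -> gg (b, e x) = r b (e x).
    exact: (dl.1 _ egg).
  by apply: filterS n3 => b; apply.
have d1 : mdiff (fun b => gg (b, e x)) (f x) by exact: mdiff_lpartial.
have d2 : mdiff (fun a => gg (f x, a)) (e x) by exact: mdiff_rpartial.
have dgg' : mdiff (fun z => gg (z.1, z.2)) (f x, e x).
  by apply: near_eq_mdiff dgg; near=> z; rewrite -surjective_pairing.
have c1 : dmap (fun y => r (f y) (e y)) x v = dmap (fun y => gg (f y, e y)) x v.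
  by rewrite (near_eq_dmap n1)//; exact: (mdiff_comp dfe dgg).
have c2 : dmap (fun y => r (f x) (e y)) x v = dmap (fun a => gg (f x, a)) (e x) (dmap e x v).
  rewrite -(near_eq_dmap n2); first exact: (dmap_comp v de d2).
  exact: (mdiff_comp de d2).
apply: (etrans c1).
apply: (etrans (@dmap_comp2 _ _ _ _ _ _ _ _ _ (fun a b => gg (a, b)) f e x v df de dgg')).
by rewrite c2 (near_eq_dmap n3).
Unshelve. all: by end_near. Qed.

End Family.

(** The orbit map is meaningful on H only; an extension to G near 1 has a tangent map to which the
    chain rule applies. *)
Lemma orbit_extension u : H 1%g ->
  exists2 q : G -> B, mdiff q 1%g & \forall a \near (1%g : G), H a -> q a = r u a.
Proof.
move=> H1; have [gg sgg egg] := r_smooth (H1 : [set z : B * G | H z.2] (u, 1%g)).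
have dgg := mC2_mdiff (smooth_at_mC2 sgg).
exists (fun a => gg (u, a)); first exact: mdiff_rpartial.
have dr := mC2_mdiff (mC2_right u (1%g : G)).
exact: (dr.1 _ egg).
Qed.

Section Orbit.
Variables (u : B) (Z : 'rV[R]_n).
Hypothesis HZ : forall t : R, H (exp (t *: Z)).

Let H1 : H 1%g.
Proof. by have := HZ 0; rewrite scale0r exponential0. Qed.

Let dq (q : G -> B) : mdiff q 1%g -> mdiff (q \o exp) 0.
Proof. exact: mdiff_comp_at (exponential0 hexp) (mdiff_exp hexp 0). Qed.

Let orbit_near (q : G -> B) : (\forall a \near (1%g : G), H a -> q a = r u a) ->
  \forall t \near (0 : R), (q \o exp) (t *: Z) = r u (exp (t *: Z)).
Proof.
move=> qr; have c : exp (t *: Z) @[t --> (0 : R)] --> (1%g : G).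
  rewrite -(exponential0 hexp) -(scale0r Z).
  apply: (@continuous_comp _ _ _ (fun t : R => t *: Z) exp 0).
    exact: scalel_continuous.
  exact: (mdiff_exp hexp _).1.
have n1 : \forall t \near (0 : R), H (exp (t *: Z)) -> q (exp (t *: Z)) = r u (exp (t *: Z)).
  exact: (c _ qr).
by apply: filterS n1 => t; apply; exact: HZ.
Qed.

Let orbit_velocity_ext (q : G -> B) : mdiff q 1%g ->
  (\forall a \near (1%g : G), H a -> q a = r u a) ->
  velocity (fun t => r u (exp (t *: Z))) 0 = dmap q 1%g Z.
Proof.
move=> dq1 qr.
apply: etrans (esym (near_eq_velocity (orbit_near qr))) _.
apply: etrans (velocity_line _ (dq dq1)) _.
apply: etrans (dmap_comp_at Z (exponential0 hexp) (mdiff_exp hexp 0) dq1) _.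
exact: congr1 (dmap_exp0 hexp Z).
Qed.

Lemma velocity_orbit {F' : normedModType R} {N : chartedType F'} (f : B -> N) :
  mdiff f u ->
  velocity (fun t => f (r u (exp (t *: Z)))) 0 =
  dmap f u (velocity (fun t => r u (exp (t *: Z))) 0).
Proof.
move=> df; have [q dq1 qr] := orbit_extension u H1.
have q1 : q 1%g = u by rewrite (nbhs_singleton qr).
have dfq : mdiff (f \o q) 1%g := mdiff_comp_at q1 dq1 df.
have n1 : \forall t \near (0 : R),
    ((f \o q) \o exp) (t *: Z) = f (r u (exp (t *: Z))).
  by apply: filterS (orbit_near qr) => t /= ->.
have dfqe := mdiff_comp_at (exponential0 hexp) (mdiff_exp hexp 0) dfq.
apply: etrans (esym (near_eq_velocity n1)) _.
apply: etrans (velocity_line _ dfqe) _.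
apply: etrans (dmap_comp_at Z (exponential0 hexp) (mdiff_exp hexp 0) dfq) _.
apply: etrans (congr1 _ (dmap_exp0 hexp Z)) _.
apply: etrans (dmap_comp_at Z q1 dq1 df) _.
exact: congr1 (esym (orbit_velocity_ext dq1 qr)).
Qed.

(** Both sides are the image of Z under the tangent map at 1 of one extension of the orbit map. *)
Lemma dmap_orbit {E : normedModType R} {N : chartedType E} (h : N -> G) x v :
  mdiff h x -> h x = 1%g -> (\forall y \near x, H (h y)) -> dmap h x v = Z ->
  dmap (fun y => r u (h y)) x v = velocity (fun t => r u (exp (t *: Z))) 0.
Proof.
move=> dh h1 hH hZ; have [q dq1 qr] := orbit_extension u H1.
have n1 : \forall y \near x, (q \o h) y = r u (h y).
  have n1 : \forall y \near x, H (h y) -> q (h y) = r u (h y).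
    by rewrite -h1 in qr; exact: (dh.1 _ qr).
  by apply: filterS2 n1 hH => y h2 h3 /=; rewrite h2.
have dqh := mdiff_comp_at h1 dh dq1.
apply: etrans (esym (congr1 (fun f => f v) (near_eq_dmap n1 dqh))) _.
apply: etrans (dmap_comp_at v h1 dh dq1) _.
apply: etrans (congr1 _ hZ) _.
exact/esym/orbit_velocity_ext.
Qed.

End Orbit.

(** In the second Leibniz term, e(y) is written as e(x) times e(x)^-1 e(y). The term becomes the
    derivative of an orbit map at the point already moved by e(x), that is, a fundamental vector. *)
Lemma dmap_act_dlog {E : normedModType R} {N : chartedType E} (f : N -> B)
    (e : N -> G) x v :
  mdiff f x -> mdiff e x ->
  (\forall y \near x, H (e y) /\ H ((e x)^-1 * e y)%g) ->
  (forall t : R, H (exp (t *: dlog e x v))) ->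
  dmap (fun y => r (f y) (e y)) x v =
  dmap (fun b => r b (e x)) (f x) (dmap f x v) +
  velocity (fun t => r (r (f x) (e x)) (exp (t *: dlog e x v))) 0.
Proof.
move=> df de eH HZ.
have eH1 : \forall y \near x, H (e y) by apply: filterS eH => y [].
have Hex := (nbhs_singleton eH).1.
rewrite (dmap_act df de eH1); congr (_ + _).
have n1 : \forall y \near x, r (r (f x) (e x)) ((e x)^-1 * e y)%g = r (f x) (e y).
  apply: filterS eH => y [h1 h2]; rewrite rM//.
  by rewrite mulVKg.
have de' := mdiff_dlog de.
have eH2 : \forall y \near x, H ((e x)^-1 * e y)%g by apply: filterS eH => y [].
have dr : mdiff (fun y => r (r (f x) (e x)) ((e x)^-1 * e y)%g) x.
  by apply: mdiff_act de' eH2; exact/mC2_mdiff/mC2_cst.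
apply: etrans (esym (congr1 (fun f => f v) (near_eq_dmap n1 dr))) _.
by apply: (dmap_orbit _ HZ de' _ eH2) => //; exact: mulVg.
Qed.

End Action.

(** * Weyl structures *)

Section LeviLogDerivative.
Context {R : realType} {n k : nat} {G : lieGroupType 'rV[R]_n}.
Context {gr : int -> {vspace 'rV[R]_n}} {exp : 'rV[R]_n -> G}.
Hypotheses (hgr : is_grading G k gr) (hexp : is_exponential exp) (hss : semisimple G).
Context {E : normedModType R} {N : chartedType E}.

Lemma dmap_mem_gr (f : N -> 'rV[R]_n) i x v : mdiff f x ->
  (\forall y \near x, f y \in gr i) -> dmap f x v \in gr i.
Proof.
move=> df fi; rewrite -(sum_gr_comp hgr (dmap f x v)); apply: memv_suml => j _.
have [->|ij] := eqVneq j i; first exact: gr_comp_mem.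
have <- := dmap_linear_comp (gr_comp k gr j) v df.
have n0 : \forall y \near x, (fun=> 0 : 'rV[R]_n) y = gr_comp k gr j (f y).
  by apply: filterS fi => y fy; rewrite (gr_comp_eq0 hgr fy)// eq_sym.
have e := congr1 (fun h => h v) (near_eq_dmap n0 (mC2_mdiff (mC2_cst _ _))).
rewrite -[X in X \in _]e.
by rewrite dmap_cst mem0v.
Qed.

(** This identifies the Lie algebra of G_0: differentiating elements that preserve every [gr i]
    gives an [ad] that preserves every [gr i]. *)
Lemma dlog_levi (e : N -> G) x v : mdiff e x ->
  (\forall y \near x, @levi R n G gr ((e x)^-1 * e y)%g) -> dlog e x v \in gr 0.
Proof.
move=> de eG; apply: (gr0_stabilizer hgr hexp hss) => i X Xi.
rewrite mul_ad_mxE.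
pose h y := ((e x)^-1 * e y)%g.
have h1 : h x = 1%g by exact: mulVg.
have dh : mdiff h x := mdiff_dlog de.
have d2 := mdiff_comp_at h1 dh (mdiff_Ad X).
have <- := dmap_comp_at v h1 dh (mdiff_Ad X).
by apply: dmap_mem_gr => //; apply: filterS eG => y Gy /=; rewrite -AdE; exact: Gy.
Qed.

End LeviLogDerivative.

(** * Pullbacks of the Cartan connection and lifts of tangent vectors *)

Section Geometry.
Context {R : realType} {n d d0 m k : nat} {G : lieGroupType 'rV[R]_n}.
Context {gr : int -> {vspace 'rV[R]_n}} {exp : 'rV[R]_n -> G}.
Hypotheses (hss : semisimple G) (hgr : is_grading G k gr) (hexp : is_exponential exp).
Context {B : manifoldType 'rV[R]_d} {B0 : manifoldType 'rV[R]_d0} {M : manifoldType 'rV[R]_m}.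
Context {p : B -> M} {r : B -> G -> B} {omega : B -> {linear 'rV[R]_d -> 'rV[R]_n}}.
Context {p0 : B0 -> M} {r0 : B0 -> G -> B0} {prj : B -> B0}.
Hypotheses (hpg : parabolic_geometry k gr exp p r omega)
  (hub : underlying_bundle k gr exp p r p0 r0 prj).

Local Notation g := 'rV[R]_n.
Local Notation P := (@parabolic R n G k gr).
Local Notation G0 := (@levi R n G gr).
Local Notation gcomp := (gr_comp k gr).
Local Notation filt := (gr_filt k gr).

Let pb := pg_bundle hpg.
Let pb0 := ub_bundle hub.

Definition fundamental (u : B0) (A : g) : 'rV[R]_d0 :=
  velocity (fun t : R => r0 u (exp (t *: A))) 0.

(** In a local trivialization v is [r0 (s (p0 v)) (tau v)]. For vertical [eta] the first Leibniz
    term of this expression vanishes, and the second is the fundamental vector of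
    [dlog tau u eta]. *)
Lemma vertical_fundamental (u : B0) (eta : 'rV[R]_d0) : tangent p0 u eta = 0 ->
  exists2 A, A \in gr 0 & eta = fundamental u A.
Proof.
move=> p0eta.
have dp0 : mdiff p0 u by exact/mC2_mdiff/smooth_at_mC2/(pb_proj_smooth pb0).
have [U [s [tau [[oU Uu] ss st sec dec]]]] := pb_trivial pb0 (p0 u).
have nU : \forall v \near u, U (p0 v).
  by apply: dp0.1; exact: open_nbhs_nbhs.
have ds : mdiff s (p0 u).
  have [gs sgs egs] := ss _ Uu; apply: near_eq_mdiff (mC2_mdiff (smooth_at_mC2 sgs)).
  have nU' : \forall y \near p0 u, U y by exact: open_nbhs_nbhs.
  by apply: filterS2 egs nU' => y; apply.
have dtau : mdiff tau u.
  have [gs sgs egs] := st _ (Uu : (p0 @^-1` U) u).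
  apply: near_eq_mdiff (mC2_mdiff (smooth_at_mC2 sgs)).
  by apply: filterS2 egs nU => y; apply.
have tauG : \forall v \near u, G0 (tau v) /\ G0 ((tau u)^-1 * tau v)%g.
  apply: filterS nU => v Uv; have Gv := (dec _ Uv).1.
  exact: conj Gv (leviM (leviV (dec _ Uu).1) Gv).
pose A := dlog tau u eta.
have A0 : A \in gr 0.
  by apply: (dlog_levi hgr hexp hss) => //; apply: filterS tauG => v [].
exists A => //.
have dsp : mdiff (s \o p0) u by exact: mdiff_comp.
have := dmap_act_dlog (pb_actM pb0) (pb_act_smooth pb0) hexp dsp dtau tauG
  (fun t => exp_levi hgr hexp t A0).
have n1 : \forall v \near u, idfun v = r0 ((s \o p0) v) (tau v).
  by apply: filterS nU => v Uv /=; rewrite (dec _ Uv).2.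
have e1 := congr1 (fun h => h eta) (near_eq_dmap n1 (mC2_mdiff (mC2_id u))).
have e2 : dmap (s \o p0) u eta = 0.
  by rewrite (dmap_comp eta dp0 ds) (dmapE p0) p0eta dmapE linear0.
move=> /(etrans e1); rewrite e2 (dmapE (fun b => r0 b _)) linear0 add0r.
rewrite /= (dec _ Uu).2 => e3.
exact: etrans (esym (dmap_id u eta)) e3.
Qed.

Lemma fundamental0 u : fundamental u 0 = 0.
Proof.
rewrite /fundamental /velocity derive1E (_ : _ \o _ = cst (cmap (chart_at u) u)) ?derive_cst//.
by apply/funext => t /=; rewrite !scaler0 exponential0// (pb_act1 pb0).
Qed.

Section Pullback.
Variable sigma : B0 -> B.
Hypothesis hsigma : weyl_structure gr r r0 prj sigma.

Lemma mdiff_weyl u : mdiff sigma u.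
Proof. exact/mC2_mdiff/smooth_at_mC2/(weyl_smooth hsigma). Qed.

Lemma pullbackE u eta : pullback omega sigma u eta = omega (sigma u) (dmap sigma u eta).
Proof. by rewrite dmapE. Qed.

Lemma pullbackD u eta eta' :
  pullback omega sigma u (eta + eta') =
  pullback omega sigma u eta + pullback omega sigma u eta'.
Proof. by rewrite !pullbackE dmapD linearD. Qed.

Lemma pullback0 u : pullback omega sigma u 0 = 0.
Proof. by rewrite /pullback !linear0. Qed.

(** Equivariance of [sigma] carries the orbit curve in B0 to one in B, on whose velocity [omega]
    returns A. *)
Lemma pullback_fundamental u A : A \in gr 0 ->
  pullback omega sigma u (fundamental u A) = A.
Proof.
move=> A0; rewrite pullbackE.
have HA t := exp_levi hgr hexp t A0.
rewrite -(velocity_orbit (pb_act1 pb0) (pb_act_smooth pb0) hexp HA (mdiff_weyl u)).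
have -> : (fun t : R => sigma (r0 u (exp (t *: A)))) = (fun t => r (sigma u) (exp (t *: A))).
  by apply/funext => t; rewrite (weyl_equivariant hsigma).
rewrite (pg_fundamental hpg)//.
by apply: subvP A0; exact: (gr_filt_sub hgr).
Qed.

End Pullback.

(** The gauge transformation law of [omega]. The condition on [dlog e u eta] ensures that its
    one-parameter group stays in P, so that its fundamental vector makes sense. *)
Lemma pullback_change (sigma sigma' : B0 -> B) (e : B0 -> G) u eta :
  weyl_structure gr r r0 prj sigma ->
  (forall v, sigma' v = r (sigma v) (e v)) -> mdiff e u -> (forall v, P (e v)) ->
  dlog e u eta \in filt 1 ->
  pullback omega sigma' u eta =
  pullback omega sigma u eta *m Ad_mx (e u)^-1%g + dlog e u eta.
Proof.
move=> hsigma se de Pe dle.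
have HZ t := exp_parabolic hgr hexp t dle.
have eP : \forall v \near u, P (e v) /\ P ((e u)^-1 * e v)%g.
  by near=> v; exact: conj (Pe v) (parabolicM (parabolicV (Pe u)) (Pe v)).
rewrite !pullbackE.
have -> : sigma' = (fun v => r (sigma v) (e v)) by apply/funext.
rewrite (dmap_act_dlog (pb_actM pb) (pb_act_smooth pb) hexp (mdiff_weyl hsigma u) de eP HZ).
rewrite linearD; congr (_ + _).
  by rewrite (dmapE (fun b => r b _)) (pg_equivariant hpg)// AdE.
rewrite (pg_fundamental hpg)//.
by apply: (gr_filt_le hgr _ dle).
Unshelve. all: by end_near. Qed.

Lemma weyl_form_lift sigma i u xi eta : weyl_structure gr r r0 prj sigma ->
  i != 0 -> tangent p0 u eta = xi ->
  weyl_form k gr omega p0 sigma i u xi = gcomp i (pullback omega sigma u eta).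
Proof.
move=> hsigma i0 xiE; rewrite /weyl_form.
have : tangent p0 u (xget 0 [set eta | tangent p0 u eta = xi]) = xi.
  by apply: (xgetPex 0 (P := [set eta | tangent p0 u eta = xi])); exists eta.
set eta' := xget _ _ => xiE'.
have : tangent p0 u (eta' - eta) = 0 by rewrite linearB /= xiE xiE' subrr.
move=> /vertical_fundamental[A A0 eA].
rewrite -(subrK eta eta') eA pullbackD pullback_fundamental// linearD /=.
by rewrite (gr_comp_eq0 hgr A0) ?add0r// eq_sym.
Qed.

Lemma hor_lift_spec sigma u xi : weyl_structure gr r r0 prj sigma ->
  (exists eta, tangent p0 u eta = xi) ->
  tangent p0 u (hor_lift k gr omega p0 sigma u xi) = xi /\
  gcomp 0 (pullback omega sigma u (hor_lift k gr omega p0 sigma u xi)) = 0.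
Proof.
move=> hsigma [eta xiE]; rewrite /hor_lift.
apply: (xgetPex 0 (P := [set eta | tangent p0 u eta = xi /\
  gcomp 0 (pullback omega sigma u eta) = 0])).
pose A := gcomp 0 (pullback omega sigma u eta).
have A0 : - A \in gr 0 by rewrite memvN; exact: gr_comp_mem.
(* Any lift becomes horizontal once its degree-0 component is cancelled by a fundamental vector,
   which is vertical since orbits stay in fibres. *)
exists (eta + fundamental u (- A)); split.
  rewrite linearD /= xiE.
  have -> : tangent p0 u (fundamental u (- A)) = 0; last by rewrite addr0.
  have HA t := exp_levi hgr hexp t A0.
  have dp0 : mdiff p0 u by exact/mC2_mdiff/smooth_at_mC2/(pb_proj_smooth pb0).
  rewrite -dmapE -(velocity_orbit (pb_act1 pb0) (pb_act_smooth pb0) hexp HA dp0).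
  rewrite /velocity derive1E (_ : _ \o _ = cst (cmap (chart_at (p0 u)) (p0 u))) ?derive_cst//.
  by apply/funext => t /=; rewrite !(pb_act_fiber pb0)//; apply: HA.
rewrite pullbackD pullback_fundamental// linearD /= (gr_comp_id hgr A0).
by rewrite subrr.
Qed.

Lemma lift_difference sigma u eta eta' : weyl_structure gr r r0 prj sigma ->
  tangent p0 u eta' = tangent p0 u eta -> gcomp 0 (pullback omega sigma u eta') = 0 ->
  eta' = eta + fundamental u (- gcomp 0 (pullback omega sigma u eta)).
Proof.
move=> hsigma et l0.
have : tangent p0 u (eta' - eta) = 0 by rewrite linearB /= et subrr.
move=> /vertical_fundamental[A A0 eA].
have eA' : eta' = eta + fundamental u A by rewrite -eA addrC subrK.
suff -> : - gcomp 0 (pullback omega sigma u eta) = A by [].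
apply: (addrI (gcomp 0 (pullback omega sigma u eta))); rewrite subrr -l0 eA'.
rewrite pullbackD (pullback_fundamental hsigma u A0) linearD /=.
by rewrite (gr_comp_id hgr A0).
Qed.

(** Brings all quantities of both Weyl structures to the one vector [eta], after which only the two
    pullbacks at [eta] have to be compared. *)
Lemma lift_spec sigma sigma' u xi :
  weyl_structure gr r r0 prj sigma -> weyl_structure gr r r0 prj sigma' ->
  let eta := hor_lift k gr omega p0 sigma u xi in
  [/\ gcomp 0 (pullback omega sigma u eta) = 0,
      forall i, i != 0 ->
        weyl_form k gr omega p0 sigma i u xi = gcomp i (pullback omega sigma u eta),
      forall i, i != 0 ->
        weyl_form k gr omega p0 sigma' i u xi = gcomp i (pullback omega sigma' u eta) &
      hor_lift k gr omega p0 sigma' u xi =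
        eta + fundamental u (- gcomp 0 (pullback omega sigma' u eta))].
Proof.
move=> hsigma hsigma' eta.
have [ex|nex] := pselect (exists eta, tangent p0 u eta = xi).
  have [l1 l2] := hor_lift_spec hsigma ex.
  have [l1' l2'] := hor_lift_spec hsigma' ex.
  have w s i : weyl_structure gr r r0 prj s -> i != 0 ->
      weyl_form k gr omega p0 s i u xi = gcomp i (pullback omega s u eta).
    by move=> hs i0; exact: weyl_form_lift hs i0 l1.
  split; [exact: l2|by move=> i; exact: w|by move=> i; exact: w|].
  exact: lift_difference hsigma' (etrans l1' (esym l1)) l2'.
(* xi has no lift: then xget gives the junk value 0 and every term vanishes *)
have x0 : xget 0 [set eta | tangent p0 u eta = xi] = 0.
  by apply: xgetPN => e he; apply: nex; exists e.
have e0 s : hor_lift k gr omega p0 s u xi = 0.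
  by apply: xgetPN => e [he _]; apply: nex; exists e.
have wE s i : weyl_form k gr omega p0 s i u xi = gcomp i (pullback omega s u 0).
  by rewrite /weyl_form x0.
rewrite /eta !e0; split; [by rewrite pullback0 linear0|by move=> i _; exact: wE|
  by move=> i _; exact: wE|].
by rewrite pullback0 linear0 oppr0 fundamental0 addr0.
Qed.

End Geometry.

(** * Multi-indices *)

Lemma big_enum_ord (T : Type) (idx : T) (op : T -> T -> T) k (F : 'I_k -> T) :
  \big[op/idx]_(a <- enum 'I_k) F a = \big[op/idx]_(a < k) F a.
Proof. by rewrite enumT /index_enum [locked_with _ _]unlock. Qed.

Lemma prod_scalemx {R : comNzRingType} n I (s : seq I) (c : I -> R) (L : I -> 'M[R]_n) :
  \prod_(i <- s) (c i *: L i) = (\prod_(i <- s) c i) *: \prod_(i <- s) L i.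
Proof.
elim: s => [|i s IH]; first by rewrite !big_nil scale1r.
by rewrite !big_cons IH -[LHS]/((_ *: _) *m (_ *: _)) -scalemxAl -scalemxAr scalerA.
Qed.

Lemma sum_scale_delta0 {R : comNzRingType} n N (L : 'M[R]_n) :
  \sum_(t < N.+1) (t == 0%N :> nat)%:R *: L ^+ t = 1.
Proof.
rewrite big_ord_recl big1 => [|i _]; last by rewrite scale0r.
by rewrite scale1r expr0 addr0.
Qed.

(** Taylor coefficients of exp(-x) and, for [dexp_coef], of (1 - exp(-x)) / x. *)
Definition Ad_coef (R : realType) (t : nat) : R := (-1) ^+ t / t`!%:R.
Definition dexp_coef (R : realType) (t : nat) : R := (-1) ^+ t / (t.+1)`!%:R.

(* the factor at a of the b-th summand of dlog (exp Y_1 ... exp Y_k) *)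
Definition dlog_coef (R : realType) k (b a : 'I_k) (t : nat) : R :=
  if (a < b)%N then (t == 0%N)%:R
  else if a == b then dexp_coef R t else Ad_coef R t.

Section MultiIndex.
Context {R : realType} {n k : nat} {G : lieGroupType 'rV[R]_n}.
Local Notation g := 'rV[R]_n.
Local Notation ad := (@ad_mx R n G).
Variable Y : 'I_k -> g.
Implicit Types (j : multi_index k) (X : g).

(** Row vectors are multiplied from the right, so the product in increasing order applies the first
    factor first, as the composite does. *)
Lemma mi_adE j X : mi_ad G Y j X = X *m \prod_(a < k) ad (Y a) ^+ j a.
Proof.
rewrite /mi_ad -big_enum_ord; elim: (enum 'I_k) X => [|a s IH] X.
  by rewrite big_nil mulmx1.
rewrite /= IH big_cons mulmxA; congr (_ *m _).
elim: (nat_of_ord (j a)) => [|t IHt]; first by rewrite expr0 mulmx1.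
by rewrite iterS IHt exprSr mulmxA mul_ad_mx.
Qed.

Lemma mi_coefE j : mi_coef R j = \prod_(a < k) ((-1) ^+ j a / (j a)`!%:R).
Proof. by rewrite /mi_coef big_split/= prodrXr prodfV natr_prod. Qed.

(** Distributivity with the order of the factors kept: a multi-index chooses one exponent in each
    factor. Its entries range exactly over the exponents of the truncated series. *)
Lemma sum_mi_prod (c : 'I_k -> 'I_(k.*2.+1) -> R) X :
  X *m \prod_(a < k) (\sum_t c a t *: ad (Y a) ^+ t) =
  \sum_(j : multi_index k) (\prod_(a < k) c a (j a)) *: mi_ad G Y j X.
Proof.
rewrite bigA_distr_bigA mulmx_sumr; apply: eq_bigr => j _.
by rewrite prod_scalemx -scalemxAr mi_adE.
Qed.

(** The factors before b force zero exponents, and the factorial of j_b + 1 at b is where the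
    denominator j_b + 1 comes from. *)
Lemma prod_dlog_coef (b : 'I_k) j :
  \prod_(a < k) dlog_coef R b a (j a) =
  if [forall a : 'I_k, (a < b)%N ==> (j a == 0%N :> nat)]
  then mi_coef R j / (j b).+1%:R else 0.
Proof.
case: ifPn => [/forallP j0|].
  rewrite mi_coefE (bigD1 b)//= [in RHS](bigD1 b)//= mulrAC.
  congr (_ * _).
    by rewrite /dlog_coef ltnn eqxx /dexp_coef factS natrM invfM [X in _ * X = _]mulrC mulrA.
  apply: eq_bigr => a /negPf ab; rewrite /dlog_coef ab.
  case: ifPn => // /(implyP (j0 a)) /eqP ->.
  by rewrite expr0 fact0 divr1.
rewrite negb_forall => /existsP[a]; rewrite negb_imply => /andP[ab ja].
by rewrite (bigD1 a)//= /dlog_coef ab (negPf ja) mul0r.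
Qed.

End MultiIndex.

(** * Adjoint action and logarithmic derivative of a product of exponentials *)

Section ProductOfExponentials.
Context {R : realType} {n k : nat} {G : lieGroupType 'rV[R]_n}.
Context {gr : int -> {vspace 'rV[R]_n}} {exp : 'rV[R]_n -> G}.
Hypotheses (hgr : is_grading G k gr) (hexp : is_exponential exp).
Local Notation g := 'rV[R]_n.
Local Notation ad := (@ad_mx R n G).
Local Notation gcomp := (gr_comp k gr).
Local Notation filt := (gr_filt k gr).

Lemma Ad_expN_mx Z : Z \in filt 1 ->
  Ad_mx (exp Z)^-1%g = \sum_(t < k.*2.+1) Ad_coef R t *: ad Z ^+ t.
Proof.
move=> Z1; apply/row_matrixP => i; rewrite !rowE -exponentialN// -scaleN1r.
rewrite (Ad_exp_nilpotent hexp _ (ad_nilpotent hgr _ Z1)) mulmx_sumr.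
by apply: eq_bigr => t _; rewrite -scalemxAr.
Qed.

Lemma dlog_exp_mx Z W : Z \in filt 1 ->
  dlog exp Z W = W *m \sum_(t < k.*2.+1) dexp_coef R t *: ad Z ^+ t.
Proof.
move=> Z1; rewrite (dlog_exp_nilpotent hexp (ad_nilpotent hgr _ Z1)) mulmx_sumr.
by apply: eq_bigr => t _; rewrite -scalemxAr.
Qed.

(** Inversion and [Ad_mx] each reverse products, so the order is preserved. *)
Lemma Ad_prod_expN I (s : seq I) (Y : I -> g) :
  Ad_mx (\big[*%g/1%g]_(a <- s) exp (Y a))^-1%g =
  \prod_(a <- s) Ad_mx (exp (Y a))^-1%g.
Proof.
elim: s => [|a s IH]; first by rewrite !big_nil invg1 Ad_mx1.
by rewrite !big_cons invgM Ad_mxM IH.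
Qed.

Lemma Ad_prod_mi (Y : 'I_k -> g) X : (forall a, Y a \in filt 1) ->
  X *m Ad_mx (\big[*%g/1%g]_(a < k) exp (Y a))^-1%g =
  \sum_(j : multi_index k) mi_coef R j *: mi_ad G Y j X.
Proof.
move=> Y1; rewrite Ad_prod_expN.
under eq_bigr => a _ do rewrite (Ad_expN_mx (Y1 a)).
rewrite (sum_mi_prod Y (fun _ t => Ad_coef R t)).
by apply: eq_bigr => j _; rewrite mi_coefE.
Qed.

Context {E : normedModType R} {N : chartedType E}.
Variables (Y : 'I_k -> N -> g) (u : N).
Hypotheses (dY : forall a, mdiff (Y a) u) (Y1 : forall a, Y a u \in filt 1).

Lemma mdiff_prod_exp (s : seq 'I_k) :
  mdiff (fun v => \big[*%g/1%g]_(a <- s) exp (Y a v)) u.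
Proof.
elim: s => [|a s IH].
  under eq_fun do rewrite big_nil.
  exact/mC2_mdiff/mC2_cst.
under eq_fun do rewrite big_cons.
apply: mdiff_mulg IH.
exact: mdiff_comp (dY a) (mdiff_exp hexp _).
Qed.

Let dlog_factor (b a : 'I_k) : 'M[R]_n :=
  \sum_(t < k.*2.+1) dlog_coef R b a t *: ad (Y a u) ^+ t.

(** By [dlog_mulg] the head contributes its own [dlog exp], acted on by the inverse of the tail,
    while in the summands of the tail the factor of the head is 1. Sortedness turns position in the
    list into the comparison of indices used in [dlog_coef]. *)
Lemma dlog_prod_exp_seq (s : seq 'I_k) v : sorted ltn (map val s) ->
  dlog (fun w => \big[*%g/1%g]_(a <- s) exp (Y a w)) u v =
  \sum_(b <- s) dmap (Y b) u v *m \prod_(a <- s) dlog_factor b a.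
Proof.
elim: s => [_|a s IH sas].
  rewrite big_nil /dlog (_ : (fun w => _) = (fun=> 1%g)); first by rewrite dmap_cst.
  by apply/funext => w; rewrite !big_nil mulVg.
have sas' : sorted ltn (map val s) := path_sorted sas.
have lt_as b : b \in s -> (a < b)%N.
  move=> bs; have /allP := order_path_min ltn_trans sas.
  by apply; exact: map_f.
have dE : dlog (fun w => \big[*%g/1%g]_(a <- a :: s) exp (Y a w)) u v =
    dlog (fun w => (exp (Y a w) * \big[*%g/1%g]_(a <- s) exp (Y a w))%g) u v.
  by congr (dlog _ u v); apply/funext => w; rewrite big_cons.
rewrite dE dlog_mulg; last 2 first.
- exact: mdiff_comp (dY a) (mdiff_exp hexp _).
- exact: mdiff_prod_exp.
rewrite big_cons; congr (_ + _).
  have e1 : dlog (fun w => exp (Y a w)) u v =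
      dmap (Y a) u v *m \sum_(t < k.*2.+1) dexp_coef R t *: ad (Y a u) ^+ t.
    exact: etrans (dlog_comp v (dY a) (mdiff_exp hexp _)) (dlog_exp_mx _ (Y1 a)).
  rewrite e1 -mulmxA big_cons; congr (_ *m _).
  rewrite -[RHS]/(_ *m _); congr (_ *m _).
    by apply: eq_bigr => t _; rewrite /dlog_coef ltnn eqxx.
  rewrite Ad_prod_expN; apply: eq_big_seq => b /lt_as ab.
  apply: (etrans (Ad_expN_mx (Y1 b))); apply: eq_bigr => t _; rewrite /dlog_coef.
  by rewrite ltnNge (ltnW ab) /= -val_eqE (gtn_eqF ab).
apply: (etrans (IH sas')); apply: eq_big_seq => b /lt_as ab; rewrite big_cons; congr (_ *m _).
suff -> : dlog_factor b a = 1 by rewrite mul1r.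
apply: (etrans _ (sum_scale_delta0 k.*2 (ad (Y a u)))).
by apply: eq_bigr => t _; rewrite /dlog_coef ab.
Qed.

Lemma dlog_prod_exp v :
  dlog (fun w => \big[*%g/1%g]_(a < k) exp (Y a w)) u v =
  \sum_(b < k) \sum_(j : multi_index k |
      [forall a : 'I_k, (a < b)%N ==> (j a == 0%N :> nat)])
    (mi_coef R j / (j b).+1%:R) *: mi_ad G (fun a => Y a u) j (dmap (Y b) u v).
Proof.
have -> : (fun w => \big[*%g/1%g]_(a < k) exp (Y a w)) =
    (fun w => \big[*%g/1%g]_(a <- enum 'I_k) exp (Y a w)).
  by apply/funext => w; rewrite big_enum_ord.
rewrite dlog_prod_exp_seq; last by rewrite val_enum_ord iota_ltn_sorted.
rewrite big_enum_ord; apply: eq_bigr => b _.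
rewrite big_enum_ord (sum_mi_prod (fun a => Y a u) (fun a t => dlog_coef R b a t)).
rewrite [RHS]big_mkcond; apply: eq_bigr => j _.
by rewrite prod_dlog_coef; case: ifP => // _; rewrite scale0r.
Qed.

End ProductOfExponentials.

(** * Change of Weyl structure *)

Section GradedMultiIndex.
Context {R : realType} {n k : nat} {G : lieGroupType 'rV[R]_n}.
Context {gr : int -> {vspace 'rV[R]_n}}.
Hypothesis hgr : is_grading G k gr.
Local Notation g := 'rV[R]_n.
Local Notation gcomp := (gr_comp k gr).
Variable Y : 'I_k -> g.
Hypothesis Ygr : forall a : 'I_k, Y a \in gr a.+1%:Z.
Implicit Types (j : multi_index k) (X : g) (i l : int).

Lemma mi_ad_mem j X l : X \in gr l -> mi_ad G Y j X \in gr ((mi_weight j)%:Z + l).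
Proof.
rewrite /mi_ad /mi_weight -big_enum_ord.
elim: (enum 'I_k) X l => [|a s IH] X l Xl; first by rewrite big_nil add0r.
have Xa : iter (j a) (bracket G (Y a)) X \in gr ((a.+1 * j a)%N%:Z + l).
  elim: (nat_of_ord (j a)) => [|t IHt]; first by rewrite muln0 add0r.
  rewrite iterS; have := gr_bracket hgr (Ygr a) IHt.
  by rewrite addrA -PoszD mulnS.
rewrite big_cons /= [X in gr (Posz X + l)]addnC PoszD -addrA.
exact: IH.
Qed.

Lemma gr_comp_sum_mi (C : pred (multi_index k)) (c : multi_index k -> R) X l i : X \in gr l ->
  gcomp i (\sum_(j | C j) c j *: mi_ad G Y j X) =
  \sum_(j | C j && ((mi_weight j)%:Z + l == i)) c j *: mi_ad G Y j X.
Proof.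
move=> Xl; rewrite linear_sum [RHS]big_mkcondr; apply: eq_bigr => j _.
rewrite linearZ /= (gr_comp_delta hgr i (mi_ad_mem j Xl)).
by case: ifP => // _; rewrite scaler0.
Qed.

(** Weights are nonnegative, so no term starting above degree i can land in it. *)
Lemma mi_sum0 (ls : seq int) (Xs : int -> g) i :
  (forall l, l \in ls -> i < l) -> mi_sum G Y ls Xs i = 0.
Proof.
move=> lsi; rewrite /mi_sum big_seq big1// => l /lsi il.
by rewrite big_pred0// => j; apply/negbTE; lia.
Qed.

End GradedMultiIndex.

(** * Homogeneous components of the transformed pullback *)

Section Main.
Context {R : realType} {n d d0 m k : nat} {G : lieGroupType 'rV[R]_n}.
Context {gr : int -> {vspace 'rV[R]_n}} {exp : 'rV[R]_n -> G}.
Hypotheses (hss : semisimple G) (hgr : is_grading G k gr) (hexp : is_exponential exp).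
Context {B : manifoldType 'rV[R]_d} {B0 : manifoldType 'rV[R]_d0} {M : manifoldType 'rV[R]_m}.
Context {p : B -> M} {r : B -> G -> B} {omega : B -> {linear 'rV[R]_d -> 'rV[R]_n}}.
Context {p0 : B0 -> M} {r0 : B0 -> G -> B0} {prj : B -> B0}.
Hypotheses (hpg : parabolic_geometry k gr exp p r omega)
  (hub : underlying_bundle k gr exp p r p0 r0 prj).
Context {sigma sigma' : B0 -> B}.
Hypotheses (hsigma : weyl_structure gr r r0 prj sigma)
  (hsigma' : weyl_structure gr r r0 prj sigma').
Variable U : 'I_k -> B0 -> 'rV[R]_n.
Hypotheses (dU : forall a u, mdiff (U a) u) (Ugr : forall (a : 'I_k) u, U a u \in gr a.+1%:Z).
Hypothesis sigmaE : forall u, sigma' u = r (sigma u) (\big[*%g/1%g]_(a < k) exp (U a u)).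
Variables (u : B0) (xi : 'rV[R]_m).

Local Notation g := 'rV[R]_n.
Local Notation gcomp := (gr_comp k gr).
Local Notation filt := (gr_filt k gr).
Local Notation neg := [seq l <- degrees k | l < 0].
Local Notation pos := [seq l <- degrees k | 0 < l].
Local Notation wform := (weyl_form k gr omega p0).

Let eta := hor_lift k gr omega p0 sigma u xi.
Let A := pullback omega sigma u eta.
Let E v := \big[*%g/1%g]_(a < k) exp (U a v).

Let U1 (a : 'I_k) v : U a v \in filt 1.
Proof. by apply: subvP (Ugr a v); apply: (gr_filt_sub hgr). Qed.

Let dUgr (a : 'I_k) : dmap (U a) u eta \in gr a.+1%:Z.
Proof. by apply: (dmap_mem_gr hgr _ (dU a u)); near=> v; exact: Ugr.
Unshelve. all: by end_near. Qed.

Let dlogE := dlog_prod_exp hgr hexp (fun a => dU a u) (fun a => U1 a u) eta.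

(** Each summand has degree b + 1 plus a weight, hence at least 1. This is the condition of
    [pullback_change], and it removes the derivative terms from degrees at most 0. *)
Let dlogE1 : dlog E u eta \in filt 1.
Proof.
rewrite /E dlogE; apply: memv_suml => b _; apply: memv_suml => j _; apply: memvZ.
apply: subvP (mi_ad_mem hgr (fun a => Ugr a u) j (dUgr b)).
by apply: (gr_filt_sub hgr); lia.
Qed.

Lemma pullback_hat : pullback omega sigma' u eta =
  \sum_(l <- degrees k) \sum_(j : multi_index k)
    mi_coef R j *: mi_ad G (fun a => U a u) j (gcomp l A) + dlog E u eta.
Proof.
have EP v : @parabolic R n G k gr (E v).
  apply: (parabolic_prod hgr) => a; rewrite -(scale1r (U a v)).
  exact: (exp_parabolic hgr hexp).
have dE : mdiff E u by exact: (mdiff_prod_exp hexp (fun a => dU a u)).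
apply: etrans (pullback_change hgr hexp hpg hsigma sigmaE dE EP dlogE1) _.
congr (_ + _); rewrite -/A -[in LHS](sum_gr_comp hgr A) mulmx_suml.
by apply: eq_bigr => l _; exact: (Ad_prod_mi hgr hexp _ (fun a => U1 a u)).
Qed.

Let lifts := lift_spec hss hgr hexp hpg hub u xi hsigma hsigma'.

Lemma gr_comp_pullback_hat i : gcomp i (pullback omega sigma' u eta) =
  mi_sum G (fun a => U a u) neg (fun l => wform sigma l u xi) i +
  mi_sum G (fun a => U a u) pos (fun l => wform sigma l u xi) i +
  gcomp i (dlog E u eta).
Proof.
have [A0 wE _ _] := lifts.
rewrite pullback_hat linearD; congr (_ + _).
rewrite linear_sum.
pose f l := \sum_(j : multi_index k | (mi_weight j)%:Z + l == i)
  mi_coef R j *: mi_ad G (fun a => U a u) j (gcomp l A).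
have fE l : gcomp i (\sum_(j : multi_index k)
    mi_coef R j *: mi_ad G (fun a => U a u) j (gcomp l A)) = f l.
  exact: (gr_comp_sum_mi hgr (fun a => Ugr a u) _ _ _ (gr_comp_mem _ _)).
(* Since [eta] is horizontal for [sigma], degree 0 drops out and the sum splits into the soldering
   part and the Rho-tensor part. *)
have f0 : f 0 = 0.
  rewrite /f big1// => j _; rewrite [gcomp 0 A]A0.
  by rewrite mi_adE mul0mx scaler0.
apply: (etrans (eq_bigr f (fun l _ => fE l))).
rewrite (bigID (fun l => l < 0)); congr (_ + _).
  rewrite /mi_sum big_filter; apply: eq_big => // l l0.
  by apply: eq_bigr => j _; rewrite wE//; move: l0; lia.
rewrite /mi_sum big_filter big_mkcond [RHS]big_mkcond; apply: eq_bigr => l _.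
case: (ltrgt0P l) => [l0|l0|->] //=.
by apply: eq_bigr => j _; rewrite wE//; lia.
Qed.

(** The Rho-tensor and the derivative of E contribute only in positive degrees. Degree 0 is included
    because it measures the change of connection in (3). *)
Lemma gr_comp_hat_le0 i : i <= 0 -> gcomp i (pullback omega sigma' u eta) =
  mi_sum G (fun a => U a u) neg (fun l => wform sigma l u xi) i.
Proof.
move=> i0; rewrite gr_comp_pullback_hat [mi_sum _ _ pos _ _]mi_sum0; last first.
  by move=> l; rewrite mem_filter => /andP[l0 _]; exact: le_lt_trans i0 l0.
have -> : gcomp i (dlog E u eta) = 0.
  by move/(mem_gr_filtP hgr) : dlogE1; apply; lia.
by rewrite !addr0.
Qed.

Lemma weyl_form_hat_neg i : i < 0 -> wform sigma' i u xi =
  mi_sum G (fun a => U a u) neg (fun l => wform sigma l u xi) i.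
Proof.
move=> i0; have [_ _ wE _] := lifts; rewrite wE; last by lia.
by apply: gr_comp_hat_le0; exact: ltW.
Qed.

Lemma weyl_form_hat_pos i : 0 < i -> wform sigma' i u xi =
  mi_sum G (fun a => U a u) neg (fun l => wform sigma l u xi) i +
  mi_sum G (fun a => U a u) pos (fun l => wform sigma l u xi) i +
  \sum_(b < k)
    \sum_(j : multi_index k |
          [forall a : 'I_k, (a < b)%N ==> (j a == 0%N :> nat)]
          && (b.+1%:Z + (mi_weight j)%:Z == i))
      (mi_coef R j / (j b).+1%:R) *:
        mi_ad G (fun a => U a u) j (nabla k gr omega p0 sigma (U b) u xi).
Proof.
move=> i0; have [_ _ wE _] := lifts; rewrite wE; last by lia.
rewrite gr_comp_pullback_hat; congr (_ + _).
rewrite /E dlogE linear_sum; apply: eq_bigr => b _.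
apply: etrans (gr_comp_sum_mi hgr (fun a => Ugr a u) _ _ _ (dUgr b)) _.
(* The derivative of [U b] along the [sigma]-horizontal lift [eta] is the covariant derivative by
   definition. *)
by apply: eq_big => [j|j _]; [rewrite addrC|rewrite dmapE].
Qed.

Lemma nabla_hat q (rho : G -> 'rV[R]_q -> 'rV[R]_q) (s : B0 -> 'rV[R]_q) :
  is_section gr r0 rho s ->
  nabla k gr omega p0 sigma' s u xi = nabla k gr omega p0 sigma s u xi +
  bullet exp rho
    (mi_sum G (fun a => U a u) neg (fun l => wform sigma l u xi) 0) (s u).
Proof.
move=> [ss sE]; have ds : mdiff s u := mC2_mdiff (smooth_at_mC2 (ss u)).
have [_ _ _ hE] := lifts.
rewrite /nabla hE -gr_comp_hat_le0// linearD; congr (_ + _).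
set C := gcomp 0 _; have C0 : - C \in gr 0 by rewrite memvN; exact: gr_comp_mem.
have HC t := exp_levi hgr hexp t C0.
have pb0 := ub_bundle hub.
rewrite -dmapE -(velocity_orbit (pb_act1 pb0) (pb_act_smooth pb0) hexp HC ds).
(* The minus sign of the lift correction cancels the inverse in the equivariance of s, so the
   correction enters (3) with a plus sign. *)
have -> : (fun t : R => s (r0 u (exp (t *: - C)))) = (fun t => rho (exp (t *: C)) (s u)).
  apply/funext => t; rewrite sE; last exact: HC.
  by rewrite scalerN exponentialN// invgK.
by [].
Qed.

End Main.

Theorem proposition3p9 (R : realType) (n d d0 m k : nat)
    (* the Lie group G, with |k|-graded semisimple Lie algebra *)
    (G : lieGroupType 'rV[R]_n) (gr : int -> {vspace 'rV[R]_n})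
    (exp : 'rV[R]_n -> G)
    (hss : semisimple G) (hgr : is_grading G k gr) (hexp : is_exponential exp)
    (* the parabolic geometry (p : B -> M, omega), and B0 -> M *)
    (B : manifoldType 'rV[R]_d) (B0 : manifoldType 'rV[R]_d0)
    (M : manifoldType 'rV[R]_m)
    (p : B -> M) (r : B -> G -> B)
    (omega : B -> {linear 'rV[R]_d -> 'rV[R]_n})
    (p0 : B0 -> M) (r0 : B0 -> G -> B0) (pi : B -> B0)
    (hpg : parabolic_geometry k gr exp p r omega)
    (hub : underlying_bundle k gr exp p r p0 r0 pi)
    (* the two Weyl structures, related by Upsilon *)
    (sigma sigma' : B0 -> B)
    (hsigma : weyl_structure gr r r0 pi sigma)
    (hsigma' : weyl_structure gr r r0 pi sigma')
    (Upsilon : B0 -> 'rV[R]_n)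
    (hU : is_section gr r0 (fun b : G => Ad b) Upsilon)
    (hUp : forall u, Upsilon u \in gr_filt k gr 1) :
  let U (a : 'I_k) (u : B0) := gr_comp k gr a.+1%:Z (Upsilon u) in
  let wform := weyl_form k gr omega p0 in
  let neg := [seq l <- degrees k | l < 0] in
  let pos := [seq l <- degrees k | 0 < l] in
  (forall u, sigma' u =
     r (sigma u) (\big[*%g/1%g]_(a < k) exp (U a u))) ->
  forall (u : B0) (xi : 'rV[R]_m),
  [/\ (* (1) *)
      forall i : int, - k%:Z <= i < 0 ->
        wform sigma' i u xi =
        mi_sum G (fun a => U a u) neg (fun l => wform sigma l u xi) i,
      (* (2) *)
      forall i : int, 0 < i <= k%:Z ->
        wform sigma' i u xi =
        mi_sum G (fun a => U a u) neg (fun l => wform sigma l u xi) i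
        + mi_sum G (fun a => U a u) pos (fun l => wform sigma l u xi) i
        + \sum_(b < k)
            \sum_(j : multi_index k |
                  [forall a : 'I_k, (a < b)%N ==> (j a == 0%N :> nat)]
                  && (b.+1%:Z + (mi_weight j)%:Z == i))
              (mi_coef R j / (j b).+1%:R) *:
                mi_ad G (fun a => U a u) j
                  (nabla k gr omega p0 sigma (U b) u xi)
    & (* (3) *)
      forall (q : nat) (rho : G -> 'rV[R]_q -> 'rV[R]_q) (s : B0 -> 'rV[R]_q),
        representation gr rho -> is_section gr r0 rho s ->
        nabla k gr omega p0 sigma' s u xi =
        nabla k gr omega p0 sigma s u xi
        + bullet exp rho
            (mi_sum G (fun a => U a u) neg (fun l => wform sigma l u xi) 0)
            (s u)].
Proof.
move=> U wform neg pos sigmaE u xi.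
have Uf a v : U a v = gr_comp k gr a.+1%:Z (Upsilon v) by [].
have dU a v : mdiff (U a) v.
  have dY : mdiff Upsilon v := mC2_mdiff (smooth_at_mC2 (hU.1 v)).
  exact: mdiff_comp dY (mdiff_linear (gr_comp k gr a.+1%:Z) _).
have Ugr (a : 'I_k) v : U a v \in gr a.+1%:Z by exact: gr_comp_mem.
split=> [i /andP[_ i0]|i /andP[i0 _]|q rho s _ hs].
- exact: (weyl_form_hat_neg hss hgr hexp hpg hub hsigma hsigma' dU Ugr sigmaE).
- exact: (weyl_form_hat_pos hss hgr hexp hpg hub hsigma hsigma' dU Ugr sigmaE).
- exact: (nabla_hat hss hgr hexp hpg hub hsigma hsigma' dU Ugr sigmaE).
Qed.
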